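(* Let $\beta,\gamma,k>0$ and $n,d\in\mathbb{N}$. Let $P^1,\dots,P^d$ be independent draws from $\mathsf{Beta}(\beta,\beta)$, and let $X\in(\{0,1\}^d)^n$ be a random dataset whose entries $X_i^j$ ($i\in[n]$, $j\in[d]$) are independent conditioned on $P=(P^1,\dots,P^d)$, with $\mathbb{E}[X_i^j\mid P]=P^j$. Let $M:(\{0,1\}^d)^n\to[-1,1]^d$ be a randomized algorithm that is $(1,\beta\gamma k/(nd))$-differentially private, and assume $$\mathbb{E}_{P,X,M}\big[\|M(X)\|_2^2\big]=k \quad\text{and}\quad \mathbb{E}_{P,X,M}\Big[\sum_{j\in[d]} M(X)^j\big(P^j-\tfrac12\big)\Big]\ge \gamma k.$$ Then $n\ge \gamma\beta\sqrt{k}$.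
   Context: A dataset $x=(x_1,\dots,x_n)\in(\{0,1\}^d)^n$ is viewed as an $n\times d$ matrix with rows $x_i$ (individuals) and columns $x^j$; two datasets are neighbors if they differ in at most one row. A randomized algorithm $M:(\{0,1\}^d)^n\to\mathcal{R}$ is $(\varepsilon,\delta)$-differentially private if for every pair of neighboring datasets $x,x'$ and every measurable $R\subseteq\mathcal{R}$, $\Pr[M(x)\in R]\le e^\varepsilon\Pr[M(x')\in R]+\delta$. $\mathsf{Beta}(\alpha,\beta)$ is the distribution on $[0,1]$ with density proportional to $p^{\alpha-1}(1-p)^{\beta-1}$. Superscript $j$ denotes the coordinate (column) index. *)

(* Defs.v *)
From HB Require Import structures.
From mathcomp Require Import all_boot all_order all_algebra.
From mathcomp Require Import all_classical all_reals all_analysis.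
Set Implicit Arguments.
Unset Strict Implicit.
Unset Printing Implicit Defensive.
Import Order.TTheory GRing.Theory Num.Theory.
Import numFieldNormedType.Exports.
Local Open Scope classical_set_scope.
Local Open Scope ring_scope.

Definition dataset (n d : nat) := n.-tuple (d.-tuple bool).

Definition neighbors (n d : nat) (x x' : dataset n d) : bool :=
  (#|[set i : 'I_n | tnth x i != tnth x' i]| <= 1)%N.

Definition diff_private (R : realType) (n d : nat)
  (M : dataset n d -> probability (d.-tuple R) R) (eps delta : R) : Prop :=
  forall x x' : dataset n d, neighbors x x' ->
  forall S : set (d.-tuple R), measurable S ->
    (M x S <= (expR eps)%:E * M x' S + delta%:E)%E.

Definition beta_kernel (R : realType) (b : R) (t : R) : R :=
  powR t (b - 1) * powR (1 - t) (b - 1).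

Definition beta_const (R : realType) (b : R) : R :=
  fine (\int[@lebesgue_measure R]_(t in `[0%R, 1%R]) (beta_kernel b t)%:E)%E.

Definition beta_mass (R : realType) (b : R) (A : set R) : \bar R :=
  ((beta_const b)^-1%:E *
   \int[@lebesgue_measure R]_(t in A `&` `[0%R, 1%R]) (beta_kernel b t)%:E)%E.

(* conditional probability of dataset x given P = p, when the entries
   X_i^j are independent Bernoulli(p^j) *)
Definition data_lik (R : realType) (n d : nat) (x : dataset n d)
  (p : d.-tuple R) : R :=
  \prod_(i < n) \prod_(j < d)
     (if tnth (tnth x i) j then tnth p j else 1 - tnth p j).

(* Main.v *)
(** If [P ~ Beta(beta, beta)] and [X_1, ..., X_n] are iid Bernoulli([P]) given [P],
    then the posterior of [P] given the ones in [X] is again a Beta law, and its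
    mean gives the fingerprinting identity
      [2 beta E[f(X) (P - 1/2)] = E[f(X) sum_i (X_i - P)]].
    Applied coordinatewise, the correlation hypothesis yields
      [2 beta gamma k <= sum_i E[Z_i]], [Z_i = sum_j M(X)^j (X_i^j - P^j)].
    By differential privacy, [E[Z_i]] is at most [e E[max(0, Z'_i)] + delta d],
    where [Z'_i] uses a fresh row independent of [M(X)].  As
    [max(0, z) <= (z + t)^2 / (4 t)], and [Z'_i] is centered with conditional
    variance [sum_j (M^j)^2 P^j (1 - P^j) <= |M|^2 / 4], the choice
    [t = sqrt k / 2] gives [E[max(0, Z'_i)] <= sqrt k / 4].  Since [e <= 4] and
    [n d delta = beta gamma k], this is [beta gamma k <= n sqrt k]. *)
Require Import Defs.
From HB Require Import structures.
From mathcomp Require Import all_boot all_order all_algebra.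
From mathcomp Require Import all_classical all_reals all_analysis.
From mathcomp Require Import finmap measurable_realfun ring lra.
Import Order.TTheory GRing.Theory Num.Theory.
Import numFieldNormedType.Exports.
Local Open Scope classical_set_scope.
Local Open Scope ring_scope.

(** * Equality of integrals from equality on indicators *)

(** Independence and conditional laws enter only as values on product events, so each is first
    promoted to an identity between integrals of functions. No conditional expectation is formed:
    for fixed parameters the average over datasets is a finite sum weighted by [data_lik], and the
    parameters are integrated last. The bound on [max(0, z)] takes the place of Cauchy-Schwarz and
    Jensen. For fixed [t], once the fresh row is averaged out, it is affine in the squared norm;
    averages over datasets and parameters then pass through it without loss, and a single [t] serves
    although only the overall mean [k] is known. The posterior mean is found without Gamma
    functions: the derivative of [t^a (1 - t)^b] integrates to [0] over [[0, 1]]. Finiteness of the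
    Beta integral is not computed either; it is read off from the total mass [1] of the prior.
    Parameters and outputs lie in their ranges only almost surely. Clamping them makes likelihoods
    and scores bounded everywhere, and their integrability immediate. *)

Section transfer.
Local Open Scope ereal_scope.
Context {R : realType} {d : measure_display} {T : measurableType d}.

Import HBNNSimple.

Lemma integral_nnsfun_weight {d1 : measure_display} {T1 : measurableType d1}
    (mu : {measure set T1 -> \bar R}) (X : T1 -> T) (h : T1 -> \bar R)
    (s : {nnsfun T >-> R}) :
  measurable_fun setT X -> measurable_fun setT h -> (forall w, 0 <= h w) ->
  let r := fset_set (range s) in
  \int[mu]_w ((s (X w))%:E * h w) =
  \sum_(i < #|`r|) (r`_i)%:E * \int[mu]_w ((\1_(s @^-1` [set r`_i]) (X w))%:E * h w).
Proof.
move=> mX mh h0 r.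
have r0 (i : 'I_#|`r|) : (0 <= r`_i)%R.
  have : r`_i \in r by rewrite mem_nth.
  by rewrite in_fset_set// => /set_mem[t _ <-].
have mI (i : 'I_#|`r|) :
    measurable_fun setT (fun w => (\1_(s @^-1` [set r`_i]) (X w))%:E * h w).
  apply: emeasurable_funM => //; apply/measurable_EFinP.
  exact: (measurableT_comp _ mX).
have I0 (i : 'I_#|`r|) w : 0 <= (\1_(s @^-1` [set r`_i]) (X w))%:E * h w.
  by rewrite mule_ge0// lee_fin.
transitivity (\int[mu]_w (\sum_(i < #|`r|) ((r`_i)%:E *
    ((\1_(s @^-1` [set r`_i]) (X w))%:E * h w)))).
  apply: eq_integral => w _; rewrite fimfunEord -sumEFin.
  rewrite ge0_sume_distrl//; last by move=> i _; rewrite lee_fin mulr_ge0.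
  by apply: eq_bigr => i _; rewrite EFinM muleA.
rewrite ge0_integral_sum//; last 2 first.
- by move=> i; exact: measurable_funeM.
- by move=> i w _; rewrite mule_ge0// lee_fin.
by apply: eq_bigr => i _; rewrite ge0_integralZl_EFin.
Qed.

Lemma cvg_integral_nnsfun_approx {d1 : measure_display} {T1 : measurableType d1}
    (mu : {measure set T1 -> \bar R}) (X : T1 -> T) (h : T1 -> \bar R)
    (f : T -> R) (mf : measurable_fun setT (EFin \o f)) :
  measurable_fun setT X -> measurable_fun setT h -> (forall w, 0 <= h w) ->
  (forall t, (0 <= f t)%R) ->
  \int[mu]_w ((nnsfun_approx measurableT mf n (X w))%:E * h w) @[n --> \oo] -->
  \int[mu]_w ((f (X w))%:E * h w).
Proof.
move=> mX mh h0 f0; set g := nnsfun_approx measurableT mf.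
have -> : \int[mu]_w ((f (X w))%:E * h w) =
    \int[mu]_w (limn (fun n => (g n (X w))%:E * h w)).
  apply: eq_integral => w _; apply/esym/cvg_lim => //.
  have gf : (g n (X w))%:E @[n --> \oo] --> (f (X w))%:E.
    by apply: (cvg_nnsfun_approx measurableT mf) => // t _; rewrite /= lee_fin.
  have := h0 w; rewrite le_eqVlt => /predU1P[<-|hw].
    by under eq_fun do rewrite mule0; rewrite mule0; exact: cvg_cst.
  case: (h w) hw => [r| |//] hw; first exact: cvgeZr.
  (* Here [h w = +oo], so the product jumps between [0] and [+oo] and convergence of the
     approximations does not suffice. If [f (X w) = 0] they all vanish, being below [f]; if
     [f (X w) > 0] they are eventually positive. *)
  have [fX0|fX0] := eqVneq (f (X w)) 0%R.
    rewrite fX0 mul0e; apply: (@cvg_near_cst _ _ _ _ eventually).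
    apply: nearW => n.
    suff -> : g n (X w) = 0%R by rewrite mul0e.
    apply/eqP; rewrite eq_le; apply/andP; split; last exact: fun_ge0.
    rewrite -lee_fin -fX0 /g nnsfun_approxE.
    by apply: (le_approx (f := EFin \o f)) => // t _; rewrite /= lee_fin.
  have fXp : (0 < f (X w))%R by rewrite lt_neqAle eq_sym fX0/=.
  rewrite gt0_muley ?lte_fin//; apply: (@cvg_near_cst _ _ _ _ eventually).
  have : \forall n \near \oo, (0 < g n (X w))%R.
    have gfR : g n (X w) @[n --> \oo] --> f (X w).
      exact: (fine_cvg gf).
    exact: (cvgr_gt _ gfR).
  by apply: filterS => n gn; rewrite gt0_muley ?lte_fin.
apply: cvg_monotone_convergence => //.
- move=> n; apply: emeasurable_funM => //; apply/measurable_EFinP.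
  exact: (measurableT_comp _ mX).
- by move=> n w _; rewrite mule_ge0// lee_fin.
- move=> w _ m n mn; rewrite lee_wpmul2r// lee_fin.
  exact/lefP/nd_nnsfun_approx.
Qed.

(** The hypothesis on indicators says that the image of [h1 mu1] under [X1] and that of [h2 mu2]
    under [X2] are the same measure on [T]; simple functions and monotone convergence do the rest.
    Explicit weights let one statement serve for densities, for restrictions to an event and for
    constants that may be infinite. *)
Lemma eq_integral_weight {d1 d2 : measure_display}
    {T1 : measurableType d1} {T2 : measurableType d2}
    (mu1 : {measure set T1 -> \bar R}) (mu2 : {measure set T2 -> \bar R})
    (X1 : T1 -> T) (X2 : T2 -> T) (h1 : T1 -> \bar R) (h2 : T2 -> \bar R)
    (f : T -> R) :
  measurable_fun setT X1 -> measurable_fun setT X2 ->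
  measurable_fun setT h1 -> measurable_fun setT h2 ->
  (forall w, 0 <= h1 w) -> (forall w, 0 <= h2 w) ->
  (forall A, measurable A ->
     \int[mu1]_w ((\1_A (X1 w))%:E * h1 w) = \int[mu2]_w ((\1_A (X2 w))%:E * h2 w)) ->
  measurable_fun setT f -> (forall t, (0 <= f t)%R) ->
  \int[mu1]_w ((f (X1 w))%:E * h1 w) = \int[mu2]_w ((f (X2 w))%:E * h2 w).
Proof.
move=> mX1 mX2 mh1 mh2 h10 h20 H mf f0.
have mf' : measurable_fun setT (EFin \o f) by exact/measurable_EFinP.
have c1 := @cvg_integral_nnsfun_approx _ _ mu1 X1 h1 f mf' mX1 mh1 h10 f0.
have c2 := @cvg_integral_nnsfun_approx _ _ mu2 X2 h2 f mf' mX2 mh2 h20 f0.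
rewrite -(cvg_lim _ c1)// -(cvg_lim _ c2)//; congr (limn _); apply/funext => n.
rewrite !integral_nnsfun_weight//; apply: eq_bigr => i _; congr (_ * _).
by apply: H.
Qed.

End transfer.

(** * Beta integrals *)

Section beta_moments.
Context {R : realType}.
Notation mu := (@lebesgue_measure R).
Implicit Types (a b t : R) (s m : nat).

Lemma is_derive_powR_mul a b t : 0 < t < 1 ->
  is_derive t 1 (fun u => u `^ a * (1 - u) `^ b)
    (a * t `^ (a - 1) * (1 - t) `^ b - t `^ a * (b * (1 - t) `^ (b - 1))).
Proof.
move=> /andP[t0 t1].
have t1' : 0 < 1 - t by rewrite subr_gt0.
have d1 : is_derive t 1 (fun u => u `^ a) (a * t `^ (a - 1)).
  exact: is_derive1_powR.
have d2 : is_derive t 1 (fun u => 1 - u : R) (- 1).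
  by rewrite -[- 1]add0r; apply: is_deriveB.
have d3 : is_derive (1 - t) 1 (fun u => u `^ b) (b * (1 - t) `^ (b - 1)).
  exact: is_derive1_powR.
have d4 := @is_derive1_comp _ (fun u => u `^ b) (fun u => 1 - u) t _ _ d3 d2.
have := is_deriveM d1 d4.
move/is_derive_eq; apply.
rewrite /GRing.scale/=; ring.
Qed.

Lemma continuous_powR a t : 0 < t -> {for t, continuous (fun u : R => u `^ a)}.
Proof.
move=> t0; apply: differentiable_continuous; apply/derivable1_diffP.
by apply: derivable_powR; rewrite in_itv/= t0.
Qed.

Lemma continuous_onem_powR a t :
  t < 1 -> {for t, continuous (fun u : R => (1 - u) `^ a)}.
Proof.
move=> t1; apply: differentiable_continuous; apply/derivable1_diffP.
have d1 : is_derive t 1 (fun u => 1 - u : R) (- 1).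
  by rewrite -[- 1]add0r; apply: is_deriveB.
have d2 : is_derive (1 - t) 1 (fun u => u `^ a) (a * (1 - t) `^ (a - 1)).
  by apply: is_derive1_powR; rewrite subr_gt0.
by have [] := @is_derive1_comp _ (fun u => u `^ a) (fun u => 1 - u) t _ _ d2 d1.
Qed.

Lemma measurable_beta_kernel a : measurable_fun setT (beta_kernel a).
Proof.
apply: measurable_funM; first exact: measurable_powR.
apply: (measurableT_comp (measurable_powR _)).
exact: measurable_funB.
Qed.

Lemma continuous_powR_mul a b : 0 < a -> 0 < b ->
  {within `[0, 1], continuous (fun u : R => u `^ a * (1 - u) `^ b)}.
Proof.
move=> a0 b0.
apply/continuous_within_itvP => //; split.
- by move=> x; rewrite in_itv/= => /andP[x0 x1]; apply: cvgM; [exact: continuous_powR|exact: continuous_onem_powR].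
- rewrite powR0 ?gt_eqF// mul0r -[X in _ --> X](mul0r ((1 - 0) `^ b)).
  apply: cvgM; first exact: powR_cvg0.
  by apply: cvg_at_right_filter; exact: continuous_onem_powR.
- rewrite subrr powR0 ?gt_eqF// mulr0 -[X in _ --> X](mulr0 (1 `^ a)).
  apply: cvgM; first by apply: cvg_at_left_filter; exact: continuous_powR.
  apply: (@cvg_comp _ _ _ (fun u : R => 1 - u) (fun u => u `^ b) _ (0^'+)).
    move=> A [e /= e0 eA]; exists e => //= u /= ue u1; apply: eA => /=.
      by rewrite sub0r normrN.
    by rewrite subr_gt0.
  exact: powR_cvg0.
Qed.

(** With [a = b0 + s] and [b = b0 + m] the integrand is the derivative of [t^a (1 - t)^b], which
    vanishes at [0] and at [1]. *)
Lemma beta_score_integral (b0 : R) s m : 0 < b0 ->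
  mu.-integrable `[0, 1] (EFin \o beta_kernel b0) ->
  \int[mu]_(t in `[0, 1]) (beta_kernel b0 t * (t ^+ s * (1 - t) ^+ m) *
    ((b0 + s%:R) - (b0 + s%:R + (b0 + m%:R)) * t)) = 0.
Proof.
move=> b00 ik; set a := b0 + s%:R; set b := b0 + m%:R.
have a0 : 0 < a by rewrite ltr_wpDr.
have bp : 0 < b by rewrite ltr_wpDr.
pose f t := beta_kernel b0 t * (t ^+ s * (1 - t) ^+ m) * (a - (a + b) * t).
rewrite -[LHS]/(\int[mu]_(t in `[0, 1]) f t).
have fE t : 0 < t < 1 -> f t =
    a * t `^ (a - 1) * (1 - t) `^ b - t `^ a * (b * (1 - t) `^ (b - 1)).
  move=> /andP[t0 t1]; have t1' : 0 < 1 - t by rewrite subr_gt0.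
  rewrite -(@mulr_powRB1 _ t a) ?ltW// -(@mulr_powRB1 _ (1 - t) b) ?ltW//.
  have -> : t `^ (a - 1) = t `^ (b0 - 1) * t ^+ s.
    by rewrite /a addrAC (@powRD _ _ _ s%:R) ?powR_mulrn ?(ltW t0)// (gt_eqF t0) implybT.
  have -> : (1 - t) `^ (b - 1) = (1 - t) `^ (b0 - 1) * (1 - t) ^+ m.
    by rewrite /b addrAC (@powRD _ _ _ m%:R) ?powR_mulrn ?(ltW t1')// (gt_eqF t1') implybT.
  rewrite /f /beta_kernel; ring.
have mf : measurable_fun setT f.
  apply: measurable_funM; last first.
    by apply: measurable_funB => //; exact: measurable_funM.
  apply: measurable_funM; first exact: measurable_beta_kernel.
  apply: measurable_funM; first exact: measurable_funX.
  by apply: measurable_funX; exact: measurable_funB.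
have fi : mu.-integrable `[0, 1] (EFin \o f).
  have ck : mu.-integrable `[0, 1] (EFin \o (fun t => (a + b) * beta_kernel b0 t)).
    have := @integrableZl _ _ _ mu _ _ (a + b) _ ik.
    move=> /(_ (measurable_itv _)).
    by apply: eq_integrable => //= t _; rewrite EFinM.
  apply: le_integrable ck => //.
    by apply/measurable_EFinP; exact: measurable_funTS.
  move=> t /=; rewrite in_itv/= => /andP[t0 t1]; rewrite lee_fin.
  have t1' : 0 <= 1 - t by rewrite subr_ge0.
  have k0 : 0 <= beta_kernel b0 t by rewrite mulr_ge0 ?powR_ge0.
  rewrite [leRHS]ger0_norm; last by rewrite mulr_ge0// addr_ge0// ltW.
  have p0 : 0 <= t ^+ s * (1 - t) ^+ m by rewrite mulr_ge0 ?exprn_ge0.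
  rewrite /f normrM ger0_norm; last exact: mulr_ge0.
  rewrite mulrC; apply: ler_pM => //; first exact: mulr_ge0.
  - rewrite ler_norml; apply/andP; split; nra.
  - rewrite -[leRHS]mulr1 ler_wpM2l// mulr_ile1 ?exprn_ge0 ?exprn_ile1//.
    by rewrite lerBlDr lerDl.
(* For [b0 < 1] the integrand may blow up at the ends, so the fundamental theorem is used only at
   interior points: [h] has derivative [0] there and is continuous up to the ends, whence
   [h 1 = h 0]. *)
pose G x := \int[mu]_(t in `[0, x]) f t.
pose h (x : R) := G x - x `^ a * (1 - x) `^ b.
have ch : {within `[0, 1], continuous h}.
  move=> x; apply: cvgB.
    exact: (parameterized_integral_continuous ler01 fi).
  exact: (@continuous_powR_mul a b a0 bp x).
have dh (x : R) : x \in `]0, 1[%R -> is_derive x 1 h ((fun=> 0) x).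
  rewrite in_itv/= => x01; have /andP[x0 x1] := x01.
  have cf : {for x, continuous f}.
    have c1 : {for x, continuous (fun u : R => 1 - u)}.
      by apply: cvgB; [exact: cvg_cst|exact: cvg_id].
    apply: cvgM; last first.
      by apply: cvgB; [exact: cvg_cst|apply: cvgM; [exact: cvg_cst|exact: cvg_id]].
    apply: cvgM.
      by apply: cvgM; [exact: continuous_powR|exact: continuous_onem_powR].
    apply: cvgM; first exact: exprn_continuous.
    apply: (@cvg_comp _ _ _ (fun u : R => 1 - u) (fun u => u ^+ m) _ _ _ c1).
    exact: exprn_continuous.
  have [dG G'] := continuous_FTC1_closed x1 fi x0 cf.
  have dG' : is_derive x 1 G (f x) by split; [exact: dG|rewrite -derive1E; exact: G'].
  have := @is_deriveB _ _ _ _ _ _ _ _ _ dG' (@is_derive_powR_mul a b x x01).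
  by move/is_derive_eq; apply; rewrite fE// subrr.
have [c _] := MVT ltr01 dh ch.
rewrite mul0r /h subrr powR0 ?gt_eqF// powR0 ?gt_eqF// mulr0 mul0r !subr0.
by rewrite /G [X in _ - X]/Rintegral set_itv1 integral_set1 subr0.
Qed.

End beta_moments.

(** * Product formula for independent coordinates *)

Section independence.
Local Open Scope ereal_scope.
Context {R : realType} {d : measure_display} {T : measurableType d}.

Lemma prode_ge0 (I : Type) (r : seq I) (p : pred I) (F : I -> \bar R) :
  (forall i, 0 <= F i) -> 0 <= \prod_(i <- r | p i) F i.
Proof. by move=> F0; elim/big_ind : _ => // x y; exact: mule_ge0. Qed.

Lemma indep_integral_prod {dO : measure_display} {Omega : measurableType dO}
    (Pr : {measure set Omega -> \bar R}) (mu : {measure set T -> \bar R})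
    (rho : T -> \bar R) (n : nat) (Z : 'I_n -> Omega -> T) :
  (forall j, measurable_fun setT (Z j)) ->
  measurable_fun setT rho -> (forall t, 0 <= rho t) ->
  (forall A : 'I_n -> set T, (forall j, measurable (A j)) ->
    Pr [set w | forall j, A j (Z j w)] =
    \prod_(j < n) \int[mu]_t ((\1_(A j) t)%:E * rho t)) ->
  forall f : 'I_n -> T -> R,
  (forall j, measurable_fun setT (f j)) -> (forall j t, (0 <= f j t)%R) ->
  \int[Pr]_w (\prod_(j < n) f j (Z j w))%:E =
  \prod_(j < n) \int[mu]_t ((f j t)%:E * rho t).
Proof.
move=> mZ mrho rho0 law.
(* [m] counts the leading coordinates whose factor may be arbitrary, the others being indicators:
   [m = 0] is the hypothesis [law], [m = n] the claim. *)
suff H m (f : 'I_n -> T -> R) : (forall j, measurable_fun setT (f j)) ->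
    (forall j t, (0 <= f j t)%R) ->
    (forall j : 'I_n, (m <= j)%N -> exists2 A, measurable A & f j = \1_A) ->
    \int[Pr]_w (\prod_(j < n) f j (Z j w))%:E =
    \prod_(j < n) \int[mu]_t ((f j t)%:E * rho t).
  by move=> f mf f0; refine (H n f mf f0 _) => j; rewrite leqNgt ltn_ord.
elim: m f => [|m IH] f mf f0 fA.
  have {fA} /choice[A fA] : forall j, exists A, measurable A /\ f j = \1_A.
    by move=> j; have [A mA ->] := fA j (leq0n _); exists A.
  have mA j : measurable (A j) by have [] := fA j.
  have fE w : (\prod_(j < n) f j (Z j w))%R = \1_[set w | forall j, A j (Z j w)] w :> R.
    rewrite indicE; case: (pselect (forall j, A j (Z j w))) => h.
      rewrite mem_set// big1// => j _; have [_ ->] := fA j.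
      by rewrite indicE mem_set.
    rewrite memNset//; move/existsNP : h => [j hj].
    by rewrite (bigD1 j)//=; have [_ ->] := fA j; rewrite indicE memNset// mul0r.
  have mAs : measurable [set w | forall j, A j (Z j w)].
    rewrite (_ : [set w | _] = \bigcap_(j in [set: 'I_n]) (Z j @^-1` A j)).
      apply: (@fin_bigcap_measurable _ _ _ setT) => [|j _]; first exact: finite_finset.
      by rewrite -[X in measurable X]setTI; exact: mZ.
    by apply/seteqP; split => w /= h; [move=> j _; exact: h|move=> j; exact: h].
  under eq_integral do rewrite fE.
  rewrite integral_indic// setIT law//.
  by apply: eq_bigr => j _; have [_ ->] := fA j.
have [nm|mn] := leqP n m.
  by apply: IH => // j mj; have := leq_trans nm mj; rewrite leqNgt ltn_ord.
(* With all factors but the [i]-th frozen, both sides are weighted integrals of that factor: weight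
   [G] on [Omega], weight [rho t * C] on [T]. The induction hypothesis makes them agree when the
   factor is an indicator, and [eq_integral_weight] extends this. [C] may be infinite, so the
   weights take extended values. *)
pose i := Ordinal mn.
pose F (g : T -> R) j := if j == i then g else f j.
have FE g w : (\prod_(j < n) F g j (Z j w) =
    g (Z i w) * \prod_(j < n | j != i) f j (Z j w))%R.
  rewrite (bigD1 i isT); congr (_ * _)%R; first by rewrite /F eqxx.
  by apply: eq_bigr => j ji; rewrite /F (negbTE ji).
pose C := \prod_(j < n | j != i) \int[mu]_t ((f j t)%:E * rho t).
have IE g : \prod_(j < n) \int[mu]_t ((F g j t)%:E * rho t) =
    \int[mu]_t ((g t)%:E * rho t) * C.
  rewrite (bigD1 i isT); congr (_ * _); first by rewrite /F eqxx.
  by apply: eq_bigr => j ji; rewrite /F (negbTE ji).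
have C0 : 0 <= C.
  by apply: prode_ge0 => j; apply: integral_ge0 => t _; rewrite mule_ge0// lee_fin.
have Ff : F (f i) = f by apply/funext => j; rewrite /F; case: eqVneq => [->|].
have mrhoC : measurable_fun setT (fun t => rho t * C).
  by under eq_fun do rewrite muleC; exact: measurable_funeM.
have weightC (g : T -> R) : measurable_fun setT g -> (forall t, (0 <= g t)%R) ->
    \int[mu]_t ((g t)%:E * (rho t * C)) = \int[mu]_t ((g t)%:E * rho t) * C.
  move=> mg g0; under eq_integral do rewrite muleA.
  rewrite ge0_integralZr//.
  - by apply: emeasurable_funM => //; exact/measurable_EFinP.
  - by move=> t _; rewrite mule_ge0// lee_fin.
pose G w := (\prod_(j < n | j != i) f j (Z j w))%R.
have mG : measurable_fun setT (EFin \o G).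
  apply/measurable_EFinP; rewrite /G.
  under eq_fun do rewrite big_mkcond/=.
  by apply: measurable_prod => j _; case: (j != i);
    [exact: (measurableT_comp (mf j) (mZ j))|exact: measurable_cst].
rewrite -Ff IE -weightC//.
under eq_integral do rewrite FE EFinM.
apply: (@eq_integral_weight _ _ _ _ _ _ _ _ _ (Z i) idfun (EFin \o G)) => //.
- exact: measurable_id.
- by move=> w; rewrite /= lee_fin prodr_ge0.
- by move=> t; rewrite mule_ge0.
- move=> A mA; rewrite (weightC \1_A)// -(IE \1_A).
  transitivity (\int[Pr]_w (\prod_(j < n) F (\1_A) j (Z j w))%:E).
    by apply: eq_integral => w _; rewrite FE EFinM.
  apply: IH => [j|j t|j mj].
  + by rewrite /F; case: ifP => _.
  + by rewrite /F; case: ifP => _.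
  + rewrite /F; case: eqVneq => [_|ji]; first by exists A.
    by apply: fA; rewrite ltn_neqAle mj eq_sym andbT; exact: ji.
Qed.

End independence.

(** * Bounded random variables *)

(** The bound holds everywhere and refers to no measure, so the class is closed under sums and
    products and its members are integrable for [Pr] and for every [M x] alike. *)
Definition bounded_measurable {R : realType} {d : measure_display}
    {T : measurableType d} (f : T -> R) : Prop :=
  measurable_fun setT f /\ exists C, forall w, `|f w| <= C.

Section bounded_measurable.
Context {R : realType} {d : measure_display} {T : measurableType d}.
Context (Q : probability T R).
Implicit Types (f g : T -> R).

Lemma bounded_measurable_cst (c : R) : bounded_measurable (fun _ : T => c).
Proof. by split; [exact: measurable_cst|exists `|c|]. Qed.

Lemma bounded_measurableD f g : bounded_measurable f -> bounded_measurable g ->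
  bounded_measurable (fun w => f w + g w).
Proof.
move=> [mf [C fC]] [mg [D gD]]; split; first exact: measurable_funD.
by exists (C + D) => w; rewrite (le_trans (ler_normD _ _))// lerD.
Qed.

Lemma bounded_measurableM f g : bounded_measurable f -> bounded_measurable g ->
  bounded_measurable (fun w => f w * g w).
Proof.
move=> [mf [C fC]] [mg [D gD]]; split; first exact: measurable_funM.
by exists (C * D) => w; rewrite normrM ler_pM.
Qed.

Lemma bounded_measurableZ (c : R) f : bounded_measurable f ->
  bounded_measurable (fun w => c * f w).
Proof. by apply: bounded_measurableM; exact: bounded_measurable_cst. Qed.

Lemma bounded_measurableB f g : bounded_measurable f -> bounded_measurable g ->
  bounded_measurable (fun w => f w - g w).
Proof.
move=> [mf [C fC]] [mg [D gD]]; split; first exact: measurable_funB.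
by exists (C + D) => w; rewrite (le_trans (ler_normB _ _))// lerD.
Qed.

Lemma bounded_measurable_sum (I : Type) (r : seq I) (F : I -> T -> R) :
  (forall i, bounded_measurable (F i)) ->
  bounded_measurable (fun w => \sum_(i <- r) F i w).
Proof.
move=> bF; elim: r => [|i r IH].
  by under eq_fun do rewrite big_nil; exact: bounded_measurable_cst.
by under eq_fun do rewrite big_cons; exact: bounded_measurableD.
Qed.

Lemma bounded_measurable_prod (I : Type) (r : seq I) (F : I -> T -> R) :
  (forall i, bounded_measurable (F i)) ->
  bounded_measurable (fun w => \prod_(i <- r) F i w).
Proof.
move=> bF; elim: r => [|i r IH].
  by under eq_fun do rewrite big_nil; exact: bounded_measurable_cst.
by under eq_fun do rewrite big_cons; exact: bounded_measurableM.
Qed.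

Lemma bounded_measurable_integrable f :
  bounded_measurable f -> Q.-integrable setT (EFin \o f).
Proof.
move=> [mf [C fC]].
have iC : Q.-integrable setT (EFin \o cst C).
  exact: finite_measure_integrable_cst.
apply: le_integrable iC => //; first exact/measurable_EFinP.
by move=> w _; rewrite /= lee_fin (le_trans (fC w))// ler_norm.
Qed.

Lemma EFin_Rintegral f : bounded_measurable f ->
  (\int[Q]_w f w)%:E = (\int[Q]_w (f w)%:E)%E.
Proof.
by move=> /bounded_measurable_integrable fi; rewrite fineK// integrable_fin_num.
Qed.

Lemma Rintegral_sum (I : Type) (r : seq I) (F : I -> T -> R) :
  (forall i, bounded_measurable (F i)) ->
  \int[Q]_w (\sum_(i <- r) F i w) = \sum_(i <- r) \int[Q]_w F i w.
Proof.
move=> bF; elim: r => [|i r IH].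
  rewrite big_nil; under eq_Rintegral do rewrite big_nil.
  by rewrite Rintegral_cst// mul0r.
rewrite big_cons -IH; under eq_Rintegral do rewrite big_cons.
by rewrite RintegralD//; apply: bounded_measurable_integrable => //;
  exact: bounded_measurable_sum.
Qed.

Lemma Rintegral_probability_cst (c : R) : \int[Q]_w c = c.
Proof.
rewrite Rintegral_cst// -[RHS]mulr1; congr (_ * _).
by apply: (@congr1 _ _ fine _ 1%E); exact: probability_setT.
Qed.

End bounded_measurable.

(** * Clamping, the normalised Beta density and its mean *)

Section beta_law.
Context {R : realType}.
Notation mu := (@lebesgue_measure R).

(** Applied with [[0, 1]] to parameters and with [[-1, 1]] to outputs, it changes them on null sets
    only, and makes likelihoods nonnegative and scores bounded at every point. *)
Definition clamp (a b t : R) : R := Num.max a (Num.min b t).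

Lemma clamp_itv (a b t : R) : a <= b -> a <= clamp a b t <= b.
Proof. by move=> ab; rewrite /clamp le_max lexx ge_max ab ge_min lexx. Qed.

Lemma clamp_id (a b t : R) : a <= t <= b -> clamp a b t = t.
Proof. by move=> /andP[at_ tb]; rewrite /clamp min_r// max_r. Qed.

Lemma measurable_clamp (a b : R) : measurable_fun setT (clamp a b).
Proof. by apply: measurable_maxr => //; exact: measurable_minr. Qed.

Definition beta_density (b t : R) : \bar R :=
  ((beta_const b)^-1 * (beta_kernel b t * \1_`[0, 1] t))%:E.

Lemma beta_kernel_ge0 (b t : R) : 0 <= beta_kernel b t.
Proof. by rewrite mulr_ge0 ?powR_ge0. Qed.

Lemma beta_const_ge0 (b : R) : 0 <= beta_const b.
Proof.
by apply: fine_ge0; apply: integral_ge0 => t _; rewrite lee_fin beta_kernel_ge0.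
Qed.

Lemma beta_density_ge0 (b t : R) : (0 <= beta_density b t)%E.
Proof. rewrite lee_fin mulr_ge0 ?invr_ge0 ?beta_const_ge0// mulr_ge0//.
exact: beta_kernel_ge0. Qed.

Lemma measurable_beta_density (b : R) : measurable_fun setT (beta_density b).
Proof.
apply/measurable_EFinP; apply: measurable_funM => //.
by apply: measurable_funM => //; exact: measurable_beta_kernel.
Qed.

Lemma integral_beta_density (b : R) (f : R -> R) :
  measurable_fun setT f -> (forall t, 0 <= f t) ->
  (\int[mu]_t ((f t)%:E * beta_density b t) =
   (beta_const b)^-1%:E * \int[mu]_(t in `[0%R, 1%R]) (f t * beta_kernel b t)%:E)%E.
Proof.
move=> mf f0; rewrite -ge0_integralZl//; last 3 first.
- apply/measurable_EFinP; apply: measurable_funTS.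
  by apply: measurable_funM => //; exact: measurable_beta_kernel.
- by move=> t _; rewrite lee_fin mulr_ge0// beta_kernel_ge0.
- by rewrite lee_fin invr_ge0 beta_const_ge0.
rewrite [RHS]integral_mkcond; apply: eq_integral => t _.
rewrite patchE /beta_density indicE; case: ifP => _.
  by rewrite mulr1 -!EFinM; congr EFin; ring.
by rewrite !mulr0 mule0.
Qed.

Lemma beta_massE (b : R) (A : set R) : measurable A ->
  beta_mass b A = (\int[mu]_t ((\1_A t)%:E * beta_density b t))%E.
Proof.
move=> mA; rewrite integral_beta_density//; congr (_ * _)%E.
rewrite integral_mkcondl; apply: eq_integral => t _.
by rewrite patchE indicE; case: ifP => _; rewrite ?mul1r ?mul0r.
Qed.

(** Were the integral infinite, [fine] would make [beta_const b] equal to [0], its inverse would be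
    [0] by convention, and the total mass would be [0]. *)
Lemma beta_kernel_integrable (b : R) : beta_mass b setT != 0%E ->
  mu.-integrable `[0, 1] (EFin \o beta_kernel b).
Proof.
move=> b0; apply/integrableP; split.
  by apply/measurable_EFinP; apply: measurable_funTS; exact: measurable_beta_kernel.
rewrite ltey; apply: contra b0 => /eqP h.
rewrite /beta_mass /beta_const setTI.
rewrite (_ : (\int[mu]_(t in `[0%R, 1%R]) (beta_kernel b t)%:E)%E = +oo%E).
  by rewrite /= invr0 mul0e.
rewrite -h; apply: eq_integral => t _ /=.
by rewrite ger0_norm// beta_kernel_ge0.
Qed.

(** The likelihood of a column containing [s] ones and [m] zeros; times the Beta(b, b) kernel, it is
    the unnormalised density of Beta(b + s, b + m). *)
Definition binom_weight (s m : nat) (t : R) : R := t ^+ s * (1 - t) ^+ m.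

Lemma measurable_binom_weight s m : measurable_fun setT (binom_weight s m).
Proof.
apply: measurable_funM; first exact: measurable_funX.
by apply: measurable_funX; exact: measurable_funB.
Qed.

Lemma binom_weight_itv s m t : 0 <= t <= 1 -> 0 <= binom_weight s m t <= 1.
Proof.
move=> /andP[t0 t1]; have t1' : 0 <= 1 - t by rewrite subr_ge0.
rewrite mulr_ge0 ?exprn_ge0//= mulr_ile1 ?exprn_ge0 ?exprn_ile1//.
by rewrite lerBlDr lerDl.
Qed.

(** The score integral split into its two terms: the mean [(b + s) / (2 b + s + m)] of Beta(b + s, b
    + m), cross-multiplied. On [[0, 1]] the clamp is the identity; outside, the density is [0] and
    the clamp only keeps the integrand nonnegative. *)
Lemma beta_moment_shift (b : R) s m : 0 < b -> beta_mass b setT != 0%E ->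
  ((b + s%:R)%:E *
     \int[mu]_t ((binom_weight s m (clamp 0 1 t))%:E * beta_density b t) =
   (b + s%:R + (b + m%:R))%:E *
     \int[mu]_t ((binom_weight s m (clamp 0 1 t) * clamp 0 1 t)%:E *
                 beta_density b t))%E.
Proof.
move=> b0 /beta_kernel_integrable ik.
have mc := measurable_clamp 0 1.
have mw : measurable_fun setT (binom_weight s m \o clamp 0 1).
  exact: (measurableT_comp (measurable_binom_weight s m) mc).
have c01 t : 0 <= clamp 0 1 t <= 1 by exact: clamp_itv.
have w01 t := binom_weight_itv s m _ (c01 t).
have bI (g : R -> R) : measurable_fun setT g -> (forall t, 0 <= g t <= 1) ->
    mu.-integrable `[0, 1] (EFin \o (fun t => g t * beta_kernel b t)).
  move=> mg g01; apply: le_integrable ik => //.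
    apply/measurable_EFinP; apply: measurable_funTS.
    by apply: measurable_funM => //; exact: measurable_beta_kernel.
  move=> t _; have /andP[g0 g1] := g01 t; have k0 := beta_kernel_ge0 b t.
  rewrite /= lee_fin [leRHS]ger0_norm// ger0_norm; last exact: mulr_ge0.
  exact: ler_piMl.
pose f1 t := binom_weight s m (clamp 0 1 t) * beta_kernel b t.
pose f2 t := binom_weight s m (clamp 0 1 t) * clamp 0 1 t * beta_kernel b t.
have wc01 t : 0 <= binom_weight s m (clamp 0 1 t) * clamp 0 1 t <= 1.
  have /andP[c0 c1] := c01 t; have /andP[w0 w1] := w01 t.
  by rewrite mulr_ge0//= mulr_ile1.
have i1 : mu.-integrable `[0, 1] (EFin \o f1) by exact: (bI _ mw w01).
have i2 : mu.-integrable `[0, 1] (EFin \o f2).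
  exact: (bI _ (measurable_funM mw mc) wc01).
have Rscore : (b + s%:R) * \int[mu]_(t in `[0, 1]) f1 t =
    (b + s%:R + (b + m%:R)) * \int[mu]_(t in `[0, 1]) f2 t.
  apply/eqP; rewrite -subr_eq0 -!RintegralZl//; apply/eqP.
  rewrite -RintegralB//; last 2 first.
  - by have := integrableZl _ (b + s%:R) i1; apply.
  - by have := integrableZl _ (b + s%:R + (b + m%:R)) i2; apply.
  rewrite -[RHS](beta_score_integral _ s m b0 ik).
  apply: eq_Rintegral => t /set_mem; rewrite /= in_itv/= => t01.
  by rewrite /f1 /f2 clamp_id// /binom_weight; ring.
have w0 t : 0 <= binom_weight s m (clamp 0 1 t) by have /andP[] := w01 t.
have wc0 t : 0 <= binom_weight s m (clamp 0 1 t) * clamp 0 1 t.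
  by have /andP[] := wc01 t.
rewrite (integral_beta_density b _ mw w0).
rewrite (integral_beta_density b _ (measurable_funM mw mc) wc0).
rewrite -[X in (_ * (_ * X) = _)%E](fineK (integrable_fin_num _ i1))//.
rewrite -[X in (_ = _ * (_ * X))%E](fineK (integrable_fin_num _ i2))//.
rewrite -!EFinM; congr EFin.
rewrite mulrCA [RHS]mulrCA; congr (_ * _); exact: Rscore.
Qed.

End beta_law.

(** * Sums over datasets *)

Section tuple_sums.
Context {R : comRingType}.

Lemma sum_tuple_prod (T : finType) (n : nat) (F : 'I_n -> T -> R) :
  \sum_(x : n.-tuple T) \prod_(i < n) F i (tnth x i) =
  \prod_(i < n) \sum_(t : T) F i t.
Proof.
rewrite bigA_distr_bigA/=.
rewrite (reindex (fun x : n.-tuple T => [ffun i => tnth x i]))/=.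
  by apply: eq_bigr => x _; apply: eq_bigr => i _; rewrite ffunE.
exists (fun f : {ffun 'I_n -> T} => [tuple f i | i < n]) => [x _|f _].
  by apply: eq_from_tnth => i; rewrite tnth_mktuple ffunE.
by apply/ffunP => i; rewrite ffunE tnth_mktuple.
Qed.

Definition set_row (T : Type) (n : nat) (x : n.-tuple T) (i : 'I_n) (r : T) :
  n.-tuple T := [tuple if k == i then r else tnth x k | k < n].

(** Row [i] and a fresh row are exchangeable: swapping them is an involution of the pairs [(x, r)]
    that preserves their weight. The scored row thus becomes independent of [x], though it is still
    in the dataset given to [G]; removing it from there is left to privacy. *)
Lemma sum_tuple_resample (T : finType) (n : nat) (w : T -> R) (i : 'I_n)
    (G : n.-tuple T -> T -> R) :
  \sum_(r : T) w r = 1 ->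
  \sum_(x : n.-tuple T) (\prod_(k < n) w (tnth x k)) * G x (tnth x i) =
  \sum_(x : n.-tuple T) \sum_(r : T)
    (\prod_(k < n) w (tnth x k)) * w r * G (set_row _ _ x i r) r.
Proof.
move=> w1; pose swap (u : n.-tuple T * T) := (set_row _ _ u.1 i u.2, tnth u.1 i).
have swapK : involutive swap.
  move=> [x r]; rewrite /swap /set_row /= tnth_mktuple eqxx; congr pair.
  apply: eq_from_tnth => k; rewrite !tnth_mktuple.
  by case: eqVneq => [->|].
rewrite pair_bigA (reindex_inj (inv_inj swapK))/=.
rewrite -(pair_bigA _ (fun x r => (\prod_(k < n) w (tnth (set_row _ _ x i r) k)) *
  w (tnth x i) * G (set_row _ _ (set_row _ _ x i r) i (tnth x i)) (tnth x i)))/=.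
apply: eq_bigr => x _.
rewrite -[LHS]mulr1 -[X in _ * X = _]w1 mulr_sumr; apply: eq_bigr => r _.
have -> : set_row _ _ (set_row _ _ x i r) i (tnth x i) = x.
  by have [] := swapK (x, r).
have -> : \prod_(k < n) w (tnth (set_row _ _ x i r) k) =
          w r * \prod_(k < n | k != i) w (tnth x k).
  rewrite (bigD1 i)//= tnth_mktuple eqxx; congr (_ * _).
  by apply: eq_bigr => k ki; rewrite tnth_mktuple (negbTE ki).
rewrite (bigD1 i)//=; ring.
Qed.

End tuple_sums.

Lemma neighbors_set_row (n d : nat) (x : dataset n d) (i : 'I_n)
  (r : d.-tuple bool) : neighbors (set_row _ _ x i r) x.
Proof.
rewrite /neighbors -(cards1 i); apply: subset_leq_card.
apply/fintype.subsetP => k /set_mem; rewrite /= tnth_mktuple finset.in_set1.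
by case: (eqVneq k i) => // _; rewrite eqxx.
Qed.

(** * Moments of a row of independent Bernoulli entries *)

Section row_likelihood.
Context {R : realType}.
Implicit Types (d : nat).

Definition row_lik {d} (p : d.-tuple R) (r : d.-tuple bool) : R :=
  \prod_(j < d) (if tnth r j then tnth p j else 1 - tnth p j).

Lemma row_lik_ge0 d (p : d.-tuple R) (r : d.-tuple bool) :
  (forall j, 0 <= tnth p j <= 1) -> 0 <= row_lik p r.
Proof.
move=> p01; apply: prodr_ge0 => j _; have /andP[p0 p1] := p01 j.
by case: ifP => _; rewrite ?subr_ge0.
Qed.

(** Coordinates are independent, so products factor; the moments below take factors equal to [1] off
    the coordinates of interest. *)
Lemma row_lik_expectation d (p : d.-tuple R) (f : 'I_d -> bool -> R) :
  \sum_(r : d.-tuple bool) row_lik p r * \prod_(j < d) f j (tnth r j) =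
  \prod_(j < d) (tnth p j * f j true + (1 - tnth p j) * f j false).
Proof.
under eq_bigr do rewrite /row_lik -big_split/=.
rewrite (sum_tuple_prod _ _ (fun j b =>
  (if b then tnth p j else 1 - tnth p j) * f j b)).
by apply: eq_bigr => j _; rewrite big_bool.
Qed.

Lemma row_lik_sum1 d (p : d.-tuple R) :
  \sum_(r : d.-tuple bool) row_lik p r = 1.
Proof.
transitivity (\sum_(r : d.-tuple bool) row_lik p r * \prod_(j < d) (1 : R)).
  by apply: eq_bigr => r _; rewrite big1 ?mulr1.
rewrite (row_lik_expectation _ _ (fun _ _ => 1)).
by apply: big1 => j _; ring.
Qed.

Lemma row_lik_mean d (p : d.-tuple R) (j : 'I_d) :
  \sum_(r : d.-tuple bool) row_lik p r * ((tnth r j)%:R - tnth p j) = 0.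
Proof.
pose f (l : 'I_d) (b : bool) : R := if l == j then b%:R - tnth p l else 1.
transitivity (\sum_(r : d.-tuple bool) row_lik p r * \prod_(l < d) f l (tnth r l)).
  apply: eq_bigr => r _; congr (_ * _).
  rewrite (bigD1 j)//= {1}/f eqxx big1 ?mulr1// => l lj.
  by rewrite /f (negbTE lj).
rewrite row_lik_expectation (bigD1 j)//= /f eqxx.
by rewrite (_ : tnth p j * _ + _ = 0) ?mul0r//=; ring.
Qed.

Lemma row_lik_cov d (p : d.-tuple R) (j l : 'I_d) :
  \sum_(r : d.-tuple bool) row_lik p r *
    (((tnth r j)%:R - tnth p j) * ((tnth r l)%:R - tnth p l)) =
  if j == l then tnth p j * (1 - tnth p j) else 0.
Proof.
pose g (i : 'I_d) (b : bool) : R := b%:R - tnth p i.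
have [<-|jl] := eqVneq j l.
  pose f (i : 'I_d) (b : bool) : R := if i == j then g i b * g i b else 1.
  transitivity (\sum_(r : d.-tuple bool) row_lik p r * \prod_(i < d) f i (tnth r i)).
    apply: eq_bigr => r _; congr (_ * _).
    rewrite (bigD1 j)//= {1}/f eqxx big1 ?mulr1// => i ij.
    by rewrite /f (negbTE ij).
  rewrite row_lik_expectation (bigD1 j)//= big1 ?mulr1; last first.
    by move=> i ij; rewrite /f (negbTE ij); ring.
  by rewrite /f eqxx /g /=; ring.
pose f (i : 'I_d) (b : bool) : R :=
  if i == j then g i b else if i == l then g i b else 1.
transitivity (\sum_(r : d.-tuple bool) row_lik p r * \prod_(i < d) f i (tnth r i)).
  apply: eq_bigr => r _; congr (_ * _).
  rewrite (bigD1 j)//= (bigD1 l)/=; last by rewrite eq_sym.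
  rewrite {1 2}/f !eqxx (negbTE (_ : l != j)) 1?eq_sym// big1 ?mulr1// => i /andP[ij il].
  by rewrite /f (negbTE ij) (negbTE il).
rewrite row_lik_expectation (bigD1 j)//= /f eqxx.
by rewrite (_ : tnth p j * _ + _ = 0) ?mul0r// /g /=; ring.
Qed.

(** In the expanded square the linear terms vanish because the row is centred, and the off-diagonal
    products vanish by independence. *)
Lemma row_lik_second_moment d (p : d.-tuple R) (y : 'I_d -> R) (t : R) :
  \sum_(r : d.-tuple bool) row_lik p r *
    (\sum_(j < d) y j * ((tnth r j)%:R - tnth p j) + t) ^+ 2 =
  t ^+ 2 + \sum_(j < d) y j ^+ 2 * (tnth p j * (1 - tnth p j)).
Proof.
pose c (r : d.-tuple bool) j := (tnth r j)%:R - tnth p j.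
transitivity (\sum_(r : d.-tuple bool) (row_lik p r * t ^+ 2 +
    \sum_(j < d) (2 * t * y j) * (row_lik p r * c r j) +
    \sum_(j < d) \sum_(l < d) (y j * y l) * (row_lik p r * (c r j * c r l)))).
  apply: eq_bigr => r _.
  have -> : \sum_(j < d) 2 * t * y j * (row_lik p r * c r j) =
      row_lik p r * (2 * t) * \sum_(j < d) y j * c r j.
    by rewrite mulr_sumr; apply: eq_bigr => j _; ring.
  have -> : \sum_(j < d) \sum_(l < d) y j * y l * (row_lik p r * (c r j * c r l)) =
      row_lik p r * ((\sum_(j < d) y j * c r j) * (\sum_(j < d) y j * c r j)).
    rewrite mulr_suml mulr_sumr; apply: eq_bigr => j _.
    by rewrite !mulr_sumr; apply: eq_bigr => l _; ring.
  rewrite -/(c r _); ring.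
rewrite !big_split/= -mulr_suml row_lik_sum1 mul1r exchange_big/=.
rewrite [X in _ + X + _]big1 ?addr0; last first.
  by move=> j _; rewrite -mulr_sumr row_lik_mean mulr0.
congr (_ + _); rewrite exchange_big/=; apply: eq_bigr => j _.
rewrite exchange_big/= (bigD1 j)//= -mulr_sumr row_lik_cov eqxx big1 ?addr0//.
by move=> l lj; rewrite -mulr_sumr row_lik_cov eq_sym (negbTE lj) mulr0.
Qed.

End row_likelihood.

(** * Privacy for expectations *)

Section dp_integral.
Context {R : realType} {dT : measure_display} {T : measurableType dT}.
Notation mu := (@lebesgue_measure R).

(* Layer cake: privacy bounds the tail probabilities of [f], and [\int[Q] f] is
   the integral of the tail over [0, D]. *)
Lemma dp_integral (Q1 Q2 : probability T R) (e delta D : R) (f : T -> R) :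
  0 <= e -> 0 <= delta -> 0 <= D ->
  (forall S, measurable S -> (Q1 S <= e%:E * Q2 S + delta%:E)%E) ->
  measurable_fun setT f -> (forall t, 0 <= f t <= D) ->
  \int[Q1]_t f t <= e * \int[Q2]_t f t + delta * D.
Proof.
move=> e0 delta0 D0 dp mf f0D.
have f0 t : 0 <= f t by have /andP[] := f0D t.
have bf : bounded_measurable f.
  by split => //; exists D => t; have /andP[? ?] := f0D t; rewrite ger0_norm.
have fmeas : f \in mfun by exact: mem_set.
pose X1 : {RV Q1 >-> R} := mfun_Sub fmeas.
pose X2 : {RV Q2 >-> R} := mfun_Sub fmeas.
have E1 : (\int[Q1]_t (f t)%:E = \int[mu]_(r in `[0%R, +oo[) ccdf X1 r)%E.
  by rewrite -ge0_expectation_ccdf// expectation_def.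
have E2 : (\int[Q2]_t (f t)%:E = \int[mu]_(r in `[0%R, +oo[) ccdf X2 r)%E.
  by rewrite -ge0_expectation_ccdf// expectation_def.
rewrite -lee_fin EFinD !EFinM !EFin_Rintegral// E1 E2.
have mI : measurable_fun setT (fun r : R => (delta * \1_`[0, D] r)%:E).
  by apply/measurable_EFinP; exact: measurable_funM.
have m1 : measurable_fun setT (ccdf X1) by exact: ccdf_measurable.
have m2 : measurable_fun setT (ccdf X2) by exact: ccdf_measurable.
have ID : (\int[mu]_(r in `[0%R, +oo[) (delta * \1_`[0, D] r)%:E = (delta * D)%:E)%E.
  under eq_integral do rewrite EFinM.
  rewrite ge0_integralZl//; last first.
    by apply/measurable_EFinP.
  rewrite integral_indic// setIidl; last first.
    by move=> r /=; rewrite !in_itv/= andbT => /andP[].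
  rewrite EFinM; congr (_ * _)%E.
  apply: (etrans (lebesgue_measure_itv _)).
  rewrite /= lte_fin; case: ltgtP D0 => // [_ _|<- _//].
  by rewrite sube0.
rewrite -EFinM -ID -ge0_integralZl_EFin//; last exact: measurable_funTS.
rewrite -ge0_integralD//; last 4 first.
- by move=> r _; rewrite mule_ge0// lee_fin.
- by apply: measurable_funeM; exact: measurable_funTS.
- by move=> r _; rewrite lee_fin mulr_ge0.
- exact: measurable_funTS.
apply: ge0_le_integral => //.
- exact: measurable_funTS.
- apply: emeasurable_funD; last exact: measurable_funTS.
  by apply: measurable_funeM; exact: measurable_funTS.
move=> r; rewrite /= in_itv/= andbT => r0.
have [rD|Dr] := leP r D.
  have -> : \1_`[0, D] r = 1 :> R by rewrite indicE mem_set//= in_itv/= r0.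
  rewrite mulr1; apply: (dp (f @^-1` `]r, +oo[)).
  by rewrite -[X in measurable X]setTI; exact: mf.
have -> : ccdf X1 r = 0%E.
  rewrite -(measure0 Q1); congr (Q1 _); apply/seteqP; split => // t.
  rewrite /= in_itv/= andbT => rf; have /andP[_ fD] := f0D t.
  by have := lt_le_trans (lt_trans Dr rf) fD; rewrite ltxx.
by rewrite adde_ge0 ?mule_ge0 ?lee_fin ?mulr_ge0.
Qed.

End dp_integral.

(** * Privacy bound for one row *)

Section per_row_bound.
Context {R : realType} {n d : nat}.
Implicit Types (p : d.-tuple R) (x : dataset n d) (r : d.-tuple bool).

Definition trunc (y : d.-tuple R) (j : 'I_d) : R := clamp (-1) 1 (tnth y j).

Lemma trunc_norm (y : d.-tuple R) j : `|trunc y j| <= 1.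
Proof. by rewrite ler_norml; apply: clamp_itv; lra. Qed.

Lemma bounded_measurable_trunc j : bounded_measurable (trunc ^~ j).
Proof.
split; last by exists 1 => y; exact: trunc_norm.
exact: (measurableT_comp (measurable_clamp _ _) (measurable_tnth j)).
Qed.

Definition mean_output (Q : probability (d.-tuple R) R) (j : 'I_d) : R :=
  \int[Q]_y trunc y j.

Definition sqnorm_output (Q : probability (d.-tuple R) R) : R :=
  \int[Q]_y \sum_(j < d) trunc y j ^+ 2.

Lemma bounded_measurable_sqnorm :
  bounded_measurable (fun y => \sum_(j < d) trunc y j ^+ 2).
Proof.
apply: bounded_measurable_sum => j; apply: bounded_measurableM;
  exact: bounded_measurable_trunc.
Qed.

Definition score p (r : d.-tuple bool) (y : d.-tuple R) : R :=
  \sum_(j < d) trunc y j * ((tnth r j)%:R - tnth p j).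

Lemma bounded_measurable_score p r : bounded_measurable (score p r).
Proof.
apply: bounded_measurable_sum => j; apply: bounded_measurableM.
  exact: bounded_measurable_trunc.
exact: bounded_measurable_cst.
Qed.

Lemma score_le p r y : (forall j, 0 <= tnth p j <= 1) -> score p r y <= d%:R.
Proof.
move=> p01; apply: (@le_trans _ _ (\sum_(j < d) 1)); last first.
  by rewrite sumr_const card_ord.
apply: ler_sum => j _; apply: le_trans (ler_norm _) _.
rewrite normrM mulr_ile1 ?trunc_norm// ler_norml; have /andP[p0 p1] := p01 j.
by case: (tnth r j) => /=; apply/andP; split; lra.
Qed.

(** [dp_integral] compares integrals of functions with values in [[0, D]]; the signed score is
    therefore cut to its positive part, which [score_le] bounds by [D = d]. *)
Definition score_pos p r (Q : probability (d.-tuple R) R) : R :=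
  \int[Q]_y Num.max 0 (score p r y).

Lemma bounded_measurable_score_pos p r :
  bounded_measurable (fun y => Num.max 0 (score p r y)).
Proof.
have [ms [C sC]] := bounded_measurable_score p r.
split; first by apply: measurable_maxr => //; exact: measurable_cst.
exists C => y; apply: le_trans (sC y).
by rewrite maxEle; case: ifP => _ //; rewrite normr0.
Qed.

Lemma mean_score_le p r (Q : probability (d.-tuple R) R) :
  \sum_(j < d) ((tnth r j)%:R - tnth p j) * mean_output Q j <= score_pos p r Q.
Proof.
have -> : \sum_(j < d) ((tnth r j)%:R - tnth p j) * mean_output Q j =
    \int[Q]_y score p r y.
  rewrite Rintegral_sum => [|j]; last first.
    apply: bounded_measurableM; last exact: bounded_measurable_cst.
    exact: bounded_measurable_trunc.
  apply: eq_bigr => j _; rewrite RintegralZr 1?mulrC//.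
  exact/bounded_measurable_integrable/bounded_measurable_trunc.
apply: le_Rintegral => //.
- exact/bounded_measurable_integrable/bounded_measurable_score.
- exact/bounded_measurable_integrable/bounded_measurable_score_pos.
- by move=> y _; rewrite le_max lexx orbT.
Qed.

(* [max 0 z <= (z + t)^2 / (4 t)] since [(z + t)^2 - 4 t z = (z - t)^2]; averaging
   over a fresh row, independent of the output, then only leaves a variance. *)
Lemma fresh_row_bound p (Q : probability (d.-tuple R) R) (t : R) :
  (forall j, 0 <= tnth p j <= 1) -> 0 < t ->
  \sum_(r : d.-tuple bool) row_lik p r * score_pos p r Q <=
  (t ^+ 2 + 4^-1 * sqnorm_output Q) / (4 * t).
Proof.
move=> p01 t0.
have bs r : bounded_measurable (fun y => row_lik p r * Num.max 0 (score p r y)).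
  exact/bounded_measurableZ/bounded_measurable_score_pos.
have -> : \sum_r row_lik p r * score_pos p r Q =
    \int[Q]_y \sum_(r : d.-tuple bool) row_lik p r * Num.max 0 (score p r y).
  rewrite Rintegral_sum//; apply: eq_bigr => r _; rewrite RintegralZl//.
  exact/bounded_measurable_integrable/bounded_measurable_score_pos.
pose g (y : d.-tuple R) := \sum_(j < d) trunc y j ^+ 2.
have bg : bounded_measurable g by exact: bounded_measurable_sqnorm.
have bG : bounded_measurable (fun y => (4 * t)^-1 * (t ^+ 2 + 4^-1 * g y)).
  apply/bounded_measurableZ/bounded_measurableD; first exact: bounded_measurable_cst.
  exact: bounded_measurableZ.
apply: (@le_trans _ _ (\int[Q]_y ((4 * t)^-1 * (t ^+ 2 + 4^-1 * g y)))); last first.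
  rewrite RintegralZl//; last first.
    apply/bounded_measurable_integrable/bounded_measurableD.
      exact: bounded_measurable_cst.
    exact: bounded_measurableZ.
  rewrite RintegralD//; last 2 first.
  - exact/bounded_measurable_integrable/bounded_measurable_cst.
  - exact/bounded_measurable_integrable/bounded_measurableZ.
  rewrite Rintegral_probability_cst RintegralZl//; last first.
    exact: (bounded_measurable_integrable _ _ bg).
  by rewrite mulrC.
apply: le_Rintegral => //.
- exact/bounded_measurable_integrable/bounded_measurable_sum.
- exact: bounded_measurable_integrable.
move=> y _; rewrite ler_pdivlMl; last by rewrite mulr_gt0.
apply: (@le_trans _ _ (\sum_(r : d.-tuple bool) row_lik p r * (score p r y + t) ^+ 2)).
  rewrite mulr_sumr; apply: ler_sum => r _; rewrite mulrCA ler_wpM2l//.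
    exact: row_lik_ge0.
  rewrite maxEle; case: ifP => s0; last by rewrite mulr0 sqr_ge0.
  rewrite -subr_ge0 (_ : _ - _ = (score p r y - t) ^+ 2) ?sqr_ge0//; ring.
rewrite /score row_lik_second_moment lerD2l mulr_sumr; apply: ler_sum => j _.
rewrite mulrC ler_wpM2r ?sqr_ge0// -subr_ge0.
by rewrite (_ : _ - _ = (tnth p j - 2^-1) ^+ 2) ?sqr_ge0//; field.
Qed.

Lemma data_lik_ge0 x p : (forall j, 0 <= tnth p j <= 1) -> 0 <= data_lik x p.
Proof. by move=> p01; apply: prodr_ge0 => i _; exact: row_lik_ge0. Qed.

Lemma data_lik_sum1 p : \sum_(x : dataset n d) data_lik x p = 1.
Proof.
rewrite (sum_tuple_prod _ _ (fun _ => row_lik p)).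
by apply: big1 => i _; exact: row_lik_sum1.
Qed.

(** With the parameters fixed, rows are independent. Row [i] is exchanged with a fresh row [r];
    privacy replaces the output on [set_row x i r] by the output on its neighbor [x], which ignores
    [r]; then [fresh_row_bound] averages over [r]. *)
Lemma per_row_bound (M : dataset n d -> probability (d.-tuple R) R)
    (delta t : R) (i : 'I_n) p :
  0 <= delta -> diff_private M 1 delta ->
  (forall j, 0 <= tnth p j <= 1) -> 0 < t ->
  \sum_(x : dataset n d) data_lik x p *
    \sum_(j < d) ((tnth (tnth x i) j)%:R - tnth p j) * mean_output (M x) j <=
  expR 1 * ((t ^+ 2 + 4^-1 *
    \sum_(x : dataset n d) data_lik x p * sqnorm_output (M x)) / (4 * t)) +
  delta * d%:R.
Proof.
move=> delta0 dp p01 t0.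
have L0 x : 0 <= data_lik x p by exact: data_lik_ge0.
apply: (@le_trans _ _ (\sum_(x : dataset n d) data_lik x p *
    score_pos p (tnth x i) (M x))).
  by apply: ler_sum => x _; rewrite ler_wpM2l// mean_score_le.
rewrite (sum_tuple_resample _ _ (row_lik p) i (fun x r => score_pos p r (M x)));
  last exact: row_lik_sum1.
apply: (@le_trans _ _ (\sum_(x : dataset n d) \sum_(r : d.-tuple bool)
    data_lik x p * row_lik p r * (expR 1 * score_pos p r (M x) + delta * d%:R))).
  apply: ler_sum => x _; apply: ler_sum => r _.
  rewrite ler_wpM2l ?mulr_ge0 ?L0 ?row_lik_ge0//.
  apply: dp_integral => //.
  - by move=> S mS; apply: dp => //; exact: neighbors_set_row.
  - by have [] := bounded_measurable_score_pos p r.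
  - by move=> y; rewrite le_max lexx ge_max ler0n score_le.
apply: (@le_trans _ _ (\sum_(x : dataset n d) data_lik x p *
    (expR 1 * ((t ^+ 2 + 4^-1 * sqnorm_output (M x)) / (4 * t)) + delta * d%:R))).
  apply: ler_sum => x _; under eq_bigr do rewrite -mulrA.
  rewrite -mulr_sumr ler_wpM2l//.
  under eq_bigr do rewrite mulrDr mulrCA.
  rewrite big_split/= -mulr_sumr -mulr_suml row_lik_sum1 mul1r lerD2r.
  by rewrite ler_wpM2l ?expR_ge0// fresh_row_bound.
(* The bound is affine in [sqnorm_output (M x)] and the likelihoods sum to [1], so averaging over
   [x] loses nothing. *)
under eq_bigr do rewrite mulrDr mulrCA.
rewrite big_split/= -mulr_sumr -mulr_suml data_lik_sum1 mul1r lerD2r.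
rewrite ler_wpM2l ?expR_ge0// -[X in X + _]mulr1 -[X in _ * X + _](data_lik_sum1 p).
rewrite !mulr_sumr -big_split/= mulr_suml; apply: ler_sum => x _.
by rewrite le_eqVlt; apply/orP; left; apply/eqP; ring.
Qed.

End per_row_bound.

(** * Joint law of parameters, data and output *)

Section joint_law.
Context {R : realType} {n d : nat} {dO : measure_display}
  {Omega : measurableType dO} (Pr : probability Omega R)
  (P : Omega -> d.-tuple R) (X : Omega -> dataset n d) (Y : Omega -> d.-tuple R)
  (M : dataset n d -> probability (d.-tuple R) R).
Context (mP : measurable_fun setT P) (mX : forall x, measurable (X @^-1` [set x]))
  (mY : measurable_fun setT Y).
Context (P01 : {ae Pr, forall w, forall j, 0 <= tnth (P w) j <= 1}).
Context (PX : forall (B : set (d.-tuple R)) (x : dataset n d), measurable B ->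
  Pr (P @^-1` B `&` X @^-1` [set x]) =
  (\int[Pr]_(w in P @^-1` B) (data_lik x (P w))%:E)%E).
Context (PXY : forall (B : set (d.-tuple R)) (x : dataset n d)
  (S : set (d.-tuple R)), measurable B -> measurable S ->
  Pr (P @^-1` B `&` X @^-1` [set x] `&` Y @^-1` S) =
  (Pr (P @^-1` B `&` X @^-1` [set x]) * M x S)%E).

Definition clamp_tuple (p : d.-tuple R) : d.-tuple R :=
  [tuple clamp 0 1 (tnth p j) | j < d].

Lemma clamp_tuple_itv p j : 0 <= tnth (clamp_tuple p) j <= 1.
Proof. by rewrite tnth_mktuple; exact: clamp_itv. Qed.

Lemma clamp_tuple_id p : (forall j, 0 <= tnth p j <= 1) -> clamp_tuple p = p.
Proof.
by move=> p01; apply: eq_from_tnth => j; rewrite tnth_mktuple clamp_id.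
Qed.

Lemma bounded_measurable_clamp_tuple j :
  bounded_measurable (fun p => tnth (clamp_tuple p) j).
Proof.
split.
  under eq_fun do rewrite tnth_mktuple.
  exact: (measurableT_comp (measurable_clamp _ _) (measurable_tnth j)).
exists 1 => p; have /andP[p0 p1] := clamp_tuple_itv p j.
by rewrite ger0_norm.
Qed.

Lemma bounded_measurable_data_lik (x : dataset n d) :
  bounded_measurable (fun p => data_lik x (clamp_tuple p)).
Proof.
apply: bounded_measurable_prod => i; apply: bounded_measurable_prod => j.
case: (tnth (tnth x i) j); first exact: bounded_measurable_clamp_tuple.
apply: bounded_measurableB; first exact: bounded_measurable_cst.
exact: bounded_measurable_clamp_tuple.
Qed.

Lemma measurable_preimageT {d1 d2 : measure_display} {T1 : measurableType d1}
    {T2 : measurableType d2} (Z : T1 -> T2) (A : set T2) :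
  measurable_fun setT Z -> measurable A -> measurable (Z @^-1` A).
Proof. by move=> mZ mA; rewrite -[X in measurable X]setTI; exact: mZ. Qed.

Lemma bounded_measurable_comp {d1 d2 : measure_display} {T1 : measurableType d1}
    {T2 : measurableType d2} (f : T2 -> R) (Z : T1 -> T2) :
  measurable_fun setT Z -> bounded_measurable f -> bounded_measurable (f \o Z).
Proof.
move=> mZ [mf [C fC]]; split; first exact: measurableT_comp.
by exists C => w; exact: fC.
Qed.

Definition lik_at (x : dataset n d) (w : Omega) : R := data_lik x (clamp_tuple (P w)).
Definition data_indic (x : dataset n d) (w : Omega) : R := \1_(X @^-1` [set x]) w.

Lemma lik_at_ge0 x w : 0 <= lik_at x w.
Proof. by apply: data_lik_ge0 => j; exact: clamp_tuple_itv. Qed.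

Lemma bounded_measurable_lik_at x : bounded_measurable (lik_at x).
Proof. exact: (bounded_measurable_comp _ _ mP (bounded_measurable_data_lik x)). Qed.

Lemma bounded_measurable_data_indic x : bounded_measurable (data_indic x).
Proof.
split; first exact: measurable_indic.
by exists 1 => w; rewrite /data_indic indicE; case: (w \in _); rewrite ?normr1 ?normr0.
Qed.

(** The parameters lie in [[0, 1]] almost surely, so clamping them alters the integrand of [PX] on a
    null set only. *)
Lemma integral_likelihood (B : set (d.-tuple R)) x : measurable B ->
  (\int[Pr]_(w in P @^-1` B) (data_lik x (P w))%:E =
   \int[Pr]_w ((\1_B (P w))%:E * (lik_at x w)%:E))%E.
Proof.
move=> mB.
transitivity (\int[Pr]_(w in P @^-1` B) (lik_at x w)%:E)%E; last first.
  rewrite integral_mkcond; apply: eq_integral => w _.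
  rewrite patchE indicE /= (_ : (w \in P @^-1` B) = (P w \in B)); last first.
    by apply/idP/idP => /set_mem h; exact: mem_set.
  by case: ifP => _; rewrite ?mul1e ?mul0e.
have mlik : measurable_fun setT (fun p : d.-tuple R => data_lik x p).
  apply: measurable_prod => i _; apply: measurable_prod => j _.
  case: (tnth (tnth x i) j); first exact: measurable_tnth.
  by apply: measurable_funB => //; exact: measurable_tnth.
apply: ae_eq_integral.
- exact: (measurable_preimageT _ _ mP mB).
- apply: measurable_funTS; apply/measurable_EFinP.
  exact: (measurableT_comp mlik mP).
- by apply: measurable_funTS; apply/measurable_EFinP; have [] := bounded_measurable_lik_at x.
- by apply: filterS P01 => w p01 _; rewrite /lik_at clamp_tuple_id.
Qed.

Lemma integral_joint (f g : d.-tuple R -> R) x :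
  measurable_fun setT f -> measurable_fun setT g ->
  (forall p, 0 <= f p) -> (forall y, 0 <= g y) ->
  (\int[Pr]_w (f (P w) * (g (Y w) * data_indic x w))%:E =
   \int[Pr]_w (f (P w) * lik_at x w)%:E * \int[M x]_y (g y)%:E)%E.
Proof.
move=> mf mg f0 g0.
have L0 w : 0 <= lik_at x w by exact: lik_at_ge0.
have I0 w : 0 <= data_indic x w by rewrite /data_indic indicE.
have G0 : (0 <= \int[M x]_y (g y)%:E)%E.
  by apply: integral_ge0 => y _; rewrite lee_fin.
have mgE : measurable_fun setT (fun y => (g y)%:E) by exact/measurable_EFinP.
have gE0 y : setT y -> (0 <= (g y)%:E)%E by rewrite lee_fin.
have mI := (bounded_measurable_data_indic x).1; have mL := (bounded_measurable_lik_at x).1.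
(* First in the output: for a fixed event [B] both sides are integrals of [g], and [PXY] is their
   equality on indicators. *)
have H1 (B : set (d.-tuple R)) : measurable B ->
    (\int[Pr]_w ((\1_B (P w))%:E * (g (Y w) * data_indic x w)%:E) =
     \int[Pr]_w ((\1_B (P w))%:E * (lik_at x w)%:E) * \int[M x]_y (g y)%:E)%E.
  move=> mB.
  have mBP : measurable_fun setT (fun w => \1_B (P w) : R).
    exact: (measurableT_comp _ mP).
  have c0 : (0 <= Pr (P @^-1` B `&` X @^-1` [set x]))%E by exact: measure_ge0.
  rewrite -integral_likelihood// -PX// -(ge0_integralZl (M x) measurableT mgE gE0 c0).
  under [RHS]eq_integral do rewrite muleC.
  transitivity (\int[Pr]_w ((g (Y w))%:E * (\1_B (P w) * data_indic x w)%:E))%E.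
    by apply: eq_integral => w _; rewrite -!EFinM; congr EFin; ring.
  apply: (@eq_integral_weight _ _ _ _ _ _ _ _ _ Y idfun
    (fun w => (\1_B (P w) * data_indic x w)%:E)
    (fun=> Pr (P @^-1` B `&` X @^-1` [set x]))) => //.
  - exact: measurable_id.
  - by apply/measurable_EFinP; exact: measurable_funM.
  - by move=> w; rewrite lee_fin mulr_ge0.
  move=> S mS.
  have mSE : measurable_fun setT (fun y => (\1_S (idfun y))%:E : \bar R).
    by apply/measurable_EFinP; exact: measurable_indic.
  have SE0 (y : d.-tuple R) : setT y -> (0 <= (\1_S (idfun y))%:E :> \bar R)%E.
    by rewrite lee_fin.
  rewrite (ge0_integralZr (M x) measurableT mSE SE0 c0).
  rewrite integral_indic// setIT muleC -PXY//.
  transitivity (\int[Pr]_w (\1_(P @^-1` B `&` X @^-1` [set x] `&` Y @^-1` S) w)%:E)%E.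
    apply: eq_integral => w _; rewrite -EFinM; congr EFin.
    rewrite !indicI/= [RHS]mulrC; congr (_ * _).
  rewrite integral_indic ?setIT//.
  apply: measurableI; last exact: (measurable_preimageT _ _ mY mS).
  by apply: measurableI; [exact: (measurable_preimageT _ _ mP mB)|exact: mX].
(* Then in the parameters: with [g] fixed, [H1] is the required equality for [f] an indicator, and
   the integral of [g] is a constant weight. *)
transitivity (\int[Pr]_w ((f (P w))%:E * (g (Y w) * data_indic x w)%:E))%E.
  by apply: eq_integral => w _; rewrite -EFinM.
have -> : (\int[Pr]_w (f (P w) * lik_at x w)%:E * \int[M x]_y (g y)%:E =
    \int[Pr]_w ((f (P w))%:E * ((lik_at x w)%:E * \int[M x]_y (g y)%:E)))%E.
  have mfL : measurable_fun setT (fun w => (f (P w) * lik_at x w)%:E).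
    by apply/measurable_EFinP; apply: measurable_funM => //; exact: measurableT_comp.
  have fL0 w : setT w -> (0 <= (f (P w) * lik_at x w)%:E)%E by rewrite lee_fin mulr_ge0.
  rewrite -(ge0_integralZr Pr measurableT mfL fL0 G0).
  by apply: eq_integral => w _; rewrite EFinM muleA.
apply: eq_integral_weight => //.
- by apply/measurable_EFinP; apply: measurable_funM => //; exact: measurableT_comp.
- by under eq_fun do rewrite muleC; apply: measurable_funeM; exact/measurable_EFinP.
- by move=> w; rewrite lee_fin mulr_ge0.
- by move=> w; rewrite mule_ge0// lee_fin.
move=> B mB; rewrite H1//.
have mBL : measurable_fun setT (fun w => ((\1_B (P w))%:E * (lik_at x w)%:E)%E).
  apply/measurable_EFinP.
  by apply: measurable_funM => //; exact: (measurableT_comp _ mP).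
have BL0 w : setT w -> (0 <= (\1_B (P w))%:E * (lik_at x w)%:E)%E.
  by rewrite lee_fin mulr_ge0.
rewrite -(ge0_integralZr Pr measurableT mBL BL0 G0).
by apply: eq_integral => w _; rewrite muleA.
Qed.

Implicit Types (f g : d.-tuple R -> R).

Lemma bounded_measurable_compP f : bounded_measurable f -> bounded_measurable (fun w => f (P w)).
Proof. by move=> bf; exact: (bounded_measurable_comp _ _ mP bf). Qed.

Lemma bounded_measurable_compY g : bounded_measurable g -> bounded_measurable (fun w => g (Y w)).
Proof. by move=> bg; exact: (bounded_measurable_comp _ _ mY bg). Qed.

Lemma bounded_measurable_joint f g x : bounded_measurable f -> bounded_measurable g ->
  bounded_measurable (fun w => f (P w) * (g (Y w) * data_indic x w)).
Proof.
move=> bf bg; apply: bounded_measurableM; first exact: bounded_measurable_compP.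
by apply: bounded_measurableM; [exact: bounded_measurable_compY|exact: bounded_measurable_data_indic].
Qed.

Lemma bounded_measurable_lik_weight f x : bounded_measurable f ->
  bounded_measurable (fun w => f (P w) * lik_at x w).
Proof. by move=> bf; apply: bounded_measurableM; [exact: bounded_measurable_compP|exact: bounded_measurable_lik_at]. Qed.

Lemma Rintegral_joint_ge0 (f g : d.-tuple R -> R) x :
  bounded_measurable f -> bounded_measurable g ->
  (forall p, 0 <= f p) -> (forall y, 0 <= g y) ->
  \int[Pr]_w (f (P w) * (g (Y w) * data_indic x w)) =
  \int[Pr]_w (f (P w) * lik_at x w) * \int[M x]_y g y.
Proof.
move=> bf bg f0 g0; apply: EFin_inj.
rewrite EFinM (EFin_Rintegral _ _ (bounded_measurable_joint _ _ x bf bg)) (EFin_Rintegral _ _ (bounded_measurable_lik_weight _ x bf)).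
rewrite (EFin_Rintegral _ _ bg); apply: integral_joint => //.
- by case: bf.
- by case: bg.
Qed.

Lemma Rintegral_joint (f g : d.-tuple R -> R) x :
  bounded_measurable f -> bounded_measurable g ->
  \int[Pr]_w (f (P w) * (g (Y w) * data_indic x w)) =
  \int[Pr]_w (f (P w) * lik_at x w) * \int[M x]_y g y.
Proof.
move=> bf bg.
(* Both sides are additive in [f]. If [C] bounds [f] in absolute value, the identity holds for the
   nonnegative [f + C] and [C], hence for their difference. The same shift is then made in [g]. *)
wlog f0 : f bf / forall p, 0 <= f p => [H|].
  have [_ [C fC]] := bf.
  have C0 : 0 <= C by exact: le_trans (normr_ge0 _) (fC [tuple 0 | j < d]).
  have bC : bounded_measurable (fun _ : d.-tuple R => C).
    exact: bounded_measurable_cst.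
  have bfC : bounded_measurable (fun p => f p + C) by exact: bounded_measurableD.
  have fC0 p : 0 <= f p + C by have := fC p; rewrite ler_norml => /andP[]; lra.
  have := H _ bfC fC0; have := H _ bC (fun=> C0).
  under [X in _ -> X = _ -> _]eq_Rintegral do rewrite mulrDl.
  under [X in _ -> _ = X * _ -> _]eq_Rintegral do rewrite mulrDl.
  rewrite (RintegralD measurableT (bounded_measurable_integrable Pr _ (bounded_measurable_joint _ _ x bf bg))
    (bounded_measurable_integrable Pr _ (bounded_measurable_joint _ _ x bC bg))).
  rewrite (RintegralD measurableT (bounded_measurable_integrable Pr _ (bounded_measurable_lik_weight _ x bf))
    (bounded_measurable_integrable Pr _ (bounded_measurable_lik_weight _ x bC))).
  by move=> ->; rewrite mulrDl => /addIr.
have [_ [C gC]] := bg.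
have C0 : 0 <= C by exact: le_trans (normr_ge0 _) (gC [tuple 0 | j < d]).
have bC : bounded_measurable (fun _ : d.-tuple R => C).
  exact: bounded_measurable_cst.
have bgC : bounded_measurable (fun p => g p + C) by exact: bounded_measurableD.
have gC0 p : 0 <= g p + C by have := gC p; rewrite ler_norml => /andP[]; lra.
have := Rintegral_joint_ge0 _ _ x bf bgC f0 gC0.
have := Rintegral_joint_ge0 _ _ x bf bC f0 (fun=> C0).
under [X in _ -> X = _ -> _]eq_Rintegral do rewrite mulrDl mulrDr.
rewrite (RintegralD measurableT (bounded_measurable_integrable Pr _ (bounded_measurable_joint _ _ x bf bg))
  (bounded_measurable_integrable Pr _ (bounded_measurable_joint _ _ x bf bC))).
rewrite (RintegralD measurableT (bounded_measurable_integrable (M x) _ bg) (bounded_measurable_integrable (M x) _ bC)).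
by move=> ->; rewrite mulrDr => /addIr.
Qed.

(** The events [X = x] partition [Omega], and on each of them the output integrates out against
    [M x]. Only the law of [P] and a finite sum remain. *)
Lemma expectation_joint (f g : d.-tuple R -> R) :
  bounded_measurable f -> bounded_measurable g ->
  \int[Pr]_w (f (P w) * g (Y w)) =
  \sum_(x : dataset n d) \int[Pr]_w (f (P w) * lik_at x w) * \int[M x]_y g y.
Proof.
move=> bf bg; under [RHS]eq_bigr do rewrite -Rintegral_joint//.
rewrite -Rintegral_sum => [|x]; last exact: bounded_measurable_joint.
apply: eq_Rintegral => w _; rewrite -mulr_sumr -mulr_sumr.
rewrite (bigD1 (X w))//= /data_indic indicE mem_set// big1 ?addr0 ?mulr1// => x xX.
by rewrite indicE memNset// => /= Xx; rewrite Xx eqxx in xX.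
Qed.

End joint_law.

(** * The Beta prior and the fingerprinting identity *)

Section beta_prior.
Context {R : realType} {n d : nat} {dO : measure_display}
  {Omega : measurableType dO} (Pr : probability Omega R)
  (P : Omega -> d.-tuple R) (b : R).
Context (mP : measurable_fun setT P).
Context (law : forall A : 'I_d -> set R, (forall j, measurable (A j)) ->
  Pr (P @^-1` [set p | forall j, A j (tnth p j)]) =
  (\prod_(j < d) beta_mass b (A j))%E).

(** [beta_mass] sees only the part of a set inside [[0, 1]], so the unit cube has the same
    probability as the whole space; the normalising constant is never evaluated. *)
Lemma beta_prior_itv : {ae Pr, forall w, forall j, 0 <= tnth (P w) j <= 1}.
Proof.
pose S : set (d.-tuple R) := [set p | forall j, 0 <= tnth p j <= 1].
have PS : Pr (P @^-1` S) = 1%E.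
  have -> : S = [set p | forall j, `[0, 1]%classic (tnth p j)].
    by apply/seteqP; split => p /= h j; have := h j; rewrite in_itv.
  rewrite (law (fun=> `[0, 1]%classic))//.
  transitivity (\prod_(j < d) beta_mass b setT)%E.
    by apply: eq_bigr => j _; rewrite /beta_mass setIid setTI.
  by rewrite -(law (fun=> setT))// (_ : _ @^-1` _ = setT) ?probability_setT//; apply/seteqP.
have mS : measurable (P @^-1` S).
  rewrite (_ : P @^-1` S = \bigcap_(j in [set: 'I_d]) (P @^-1` [set p | 0 <= tnth p j <= 1])).
    apply: fin_bigcap_measurable; first exact: finite_finset.
    move=> j _; apply: (measurable_preimageT _ _ mP).
    rewrite (_ : [set p | _] = (fun p : d.-tuple R => tnth p j) @^-1` `[0, 1]%classic).
      by apply: measurable_preimageT => //; exact: measurable_tnth.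
    by apply/seteqP; split => p /=; rewrite in_itv.
  by apply/seteqP; split => w /= h; [move=> j _; exact: h|move=> j; exact: h].
exists (~` (P @^-1` S)); split.
- exact: measurableC.
- by rewrite probability_setC// PS subee.
- by move=> w /=.
Qed.

(** The total masses multiply to [1], so none is [0]. Through [beta_kernel_integrable] this yields
    convergence of the Beta integral. *)
Lemma beta_prior_mass_neq0 : (0 < d)%N -> beta_mass b setT != 0%E.
Proof.
move=> d0; apply/eqP => b0.
have := law (fun=> setT) (fun=> measurableT).
rewrite (_ : _ @^-1` _ = setT); last by apply/seteqP.
rewrite probability_setT (bigD1 (Ordinal d0))//= b0 mul0e => /eqP.
by rewrite onee_eq0.
Qed.

Definition col_ones (x : dataset n d) (j : 'I_d) : nat :=
  (\sum_(i < n) tnth (tnth x i) j)%N.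

Definition col_zeros (x : dataset n d) (j : 'I_d) : nat :=
  (\sum_(i < n) ~~ tnth (tnth x i) j)%N.

Lemma col_ones_zeros x j : (col_ones x j + col_zeros x j = n)%N.
Proof.
rewrite /col_ones /col_zeros -big_split/= -[RHS]card_ord -sum1_card.
by apply: eq_bigr => i _; case: (tnth _ j).
Qed.

Lemma data_lik_col (x : dataset n d) (p : d.-tuple R) :
  data_lik x p = \prod_(j < d) binom_weight (col_ones x j) (col_zeros x j) (tnth p j).
Proof.
rewrite /data_lik exchange_big/=; apply: eq_bigr => j _.
rewrite /binom_weight /col_ones /col_zeros -!prodrXr -big_split/=.
by apply: eq_bigr => i _; case: (tnth _ j); rewrite /= ?expr1 ?expr0 ?mulr1 ?mul1r.
Qed.

Lemma beta_prior_prod (f : 'I_d -> R -> R) :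
  (forall j, measurable_fun setT (f j)) -> (forall j t, 0 <= f j t) ->
  (\int[Pr]_w (\prod_(j < d) f j (tnth (P w) j))%:E =
   \prod_(j < d) \int[@lebesgue_measure R]_t ((f j t)%:E * beta_density b t))%E.
Proof.
move=> mf f0.
apply: (indep_integral_prod Pr (@lebesgue_measure R) (beta_density b) d
  (fun j w => tnth (P w) j)) => //.
- by move=> j; exact: (measurableT_comp (measurable_tnth j) mP).
- exact: measurable_beta_density.
- by move=> t; exact: beta_density_ge0.
- move=> A mA; apply: (etrans (law A mA)); apply: eq_bigr => j _; exact: (beta_massE _ _ (mA j)).
Qed.

(* The posterior of [P^j] given [X = x] is Beta(b + ones, b + zeros), of mean
   [(b + ones) / (2 b + n)]. *)
Lemma posterior_mean (x : dataset n d) (j : 'I_d) : 0 < b ->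
  (b + (col_ones x j)%:R) * \int[Pr]_w lik_at P x w =
  (b + b + n%:R) *
  \int[Pr]_w (lik_at P x w * tnth (clamp_tuple (P w)) j).
Proof.
move=> b0.
have bw0 l t : 0 <= binom_weight (col_ones x l) (col_zeros x l) (clamp 0 1 t) :> R.
  by have /andP[] := binom_weight_itv (col_ones x l) (col_zeros x l) _
    (clamp_itv 0 1 t ler01).
have c0 t : 0 <= clamp 0 1 t :> R by have /andP[] := clamp_itv 0 1 t ler01.
have mc : measurable_fun setT (clamp (0 : R) 1) by exact: measurable_clamp.
have mbw l : measurable_fun setT
    (fun t : R => binom_weight (col_ones x l) (col_zeros x l) (clamp 0 1 t)).
  exact: (measurableT_comp (measurable_binom_weight _ _) mc).
have bL := bounded_measurable_lik_at P mP x.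
have bc : bounded_measurable (fun w => tnth (clamp_tuple (P w)) j).
  exact: (bounded_measurable_comp _ _ mP (bounded_measurable_clamp_tuple j)).
pose f (l : 'I_d) (t : R) : R := binom_weight (col_ones x l) (col_zeros x l) (clamp 0 1 t) *
  (if l == j then clamp 0 1 t else 1).
have mf l : measurable_fun setT (f l).
  by apply: measurable_funM => //; case: (l == j).
have f0 l t : 0 <= f l t by rewrite /f mulr_ge0//; case: ifP.
apply: EFin_inj.
rewrite !EFinM (EFin_Rintegral _ _ bL) (EFin_Rintegral _ _ (bounded_measurableM _ _ bL bc)).
have -> : (\int[Pr]_w (lik_at P x w)%:E =
    \prod_(l < d) \int[@lebesgue_measure R]_t ((binom_weight (col_ones x l)
      (col_zeros x l) (clamp 0 1 t))%:E * beta_density b t))%E.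
  rewrite -beta_prior_prod//; apply: eq_integral => w _; congr EFin.
  by rewrite /lik_at data_lik_col; apply: eq_bigr => l _; rewrite tnth_mktuple.
have -> : (\int[Pr]_w (lik_at P x w * tnth (clamp_tuple (P w)) j)%:E =
    \prod_(l < d) \int[@lebesgue_measure R]_t ((f l t)%:E * beta_density b t))%E.
  rewrite -beta_prior_prod//; apply: eq_integral => w _; congr EFin.
  rewrite /lik_at data_lik_col /f [in RHS]big_split/=; congr (_ * _).
    by apply: eq_bigr => l _; rewrite tnth_mktuple.
  rewrite (bigD1 j)//= eqxx big1 ?mulr1 ?tnth_mktuple// => l lj.
  by rewrite (negbTE lj).
(* Only column [j] differs between the two products. There [beta_moment_shift] applies, and its
   constant is [2 b + n] because ones and zeros add up to [n]. *)
rewrite (bigD1 j isT) [in RHS](bigD1 j isT) !muleA; congr (_ * _)%E; last first.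
  apply: eq_bigr => l lj; apply: eq_integral => t _.
  by rewrite /f (negbTE lj) mulr1.
have d0 : (0 < d)%N by exact: leq_ltn_trans (ltn_ord j).
rewrite beta_moment_shift//; last exact: beta_prior_mass_neq0.
congr (_%:E * _)%E.
  by rewrite -[in RHS](col_ones_zeros x j) natrD; ring.
by apply: eq_integral => t _; rewrite /f eqxx.
Qed.

(** Summed over the rows, the deviations give the number of ones minus [n P^j]. With [u] and [v] the
    integrals of the likelihood and of the likelihood times [P^j], [posterior_mean] turns
    [ones u - n v] into [2 b v - b u], which is [2 b (v - u / 2)]. *)
Lemma fingerprinting (x : dataset n d) (j : 'I_d) : 0 < b ->
  2 * b * \int[Pr]_w ((tnth (clamp_tuple (P w)) j - 2^-1) * lik_at P x w) =
  \sum_(i < n) \int[Pr]_w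
    (lik_at P x w * ((tnth (tnth x i) j)%:R - tnth (clamp_tuple (P w)) j)).
Proof.
move=> b0.
have bL := bounded_measurable_lik_at P mP x.
have bc : bounded_measurable (fun w => tnth (clamp_tuple (P w)) j).
  exact: (bounded_measurable_comp _ _ mP (bounded_measurable_clamp_tuple j)).
have bLc := bounded_measurableM _ _ bL bc.
have iL := bounded_measurable_integrable Pr _ bL.
have iLc := bounded_measurable_integrable Pr _ bLc.
have lin (u v : R) : \int[Pr]_w (u * lik_at P x w +
    v * (lik_at P x w * tnth (clamp_tuple (P w)) j)) =
    u * \int[Pr]_w lik_at P x w +
    v * \int[Pr]_w (lik_at P x w * tnth (clamp_tuple (P w)) j).
  rewrite RintegralD//; last 2 first.
  - exact/bounded_measurable_integrable/bounded_measurableZ.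
  - exact/bounded_measurable_integrable/bounded_measurableZ.
  by rewrite !RintegralZl.
have -> : \int[Pr]_w ((tnth (clamp_tuple (P w)) j - 2^-1) * lik_at P x w) =
    \int[Pr]_w (- 2^-1 * lik_at P x w +
    1 * (lik_at P x w * tnth (clamp_tuple (P w)) j)).
  by apply: eq_Rintegral => w _; ring.
have E i : \int[Pr]_w (lik_at P x w *
      ((tnth (tnth x i) j)%:R - tnth (clamp_tuple (P w)) j)) =
    \int[Pr]_w ((tnth (tnth x i) j)%:R * lik_at P x w +
      (-1) * (lik_at P x w * tnth (clamp_tuple (P w)) j)).
  by apply: eq_Rintegral => w _; ring.
under eq_bigr do rewrite E lin.
rewrite lin big_split/= -mulr_suml -natr_sum -/(col_ones x j) sumr_const card_ord.
rewrite -[_ *+ n]mulr_natl; have := posterior_mean x j b0.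
set u := \int[Pr]_w _; set v := \int[Pr]_w _.
move=> H; have -> : (col_ones x j)%:R * u = (b + b + n%:R) * v - b * u.
  by rewrite -H; ring.
by field.
Qed.

End beta_prior.

(** * The lower bound on the number of rows *)

Lemma expR1_le4 (R : realType) : expR 1 <= 4 :> R.
Proof.
(* From [1 + x <= exp x] at [x = -1/2]; inverting and squaring then gives the bound. *)
have h : expR (- 2^-1) >= 2^-1 :> R.
  by apply: le_trans (expR_ge1Dx _); lra.
have e0 : 0 < expR 2^-1 :> R by exact: expR_gt0.
have e2 : expR 2^-1 <= 2 :> R.
  by rewrite -lef_pV2 ?posrE// -expRN.
rewrite (_ : (1 : R) = 2^-1 + 2^-1); last by lra.
by rewrite expRD; nra.
Qed.

Theorem theorem3p1 (R : realType) (beta gamma k : R) (n d : nat)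
  (dO : measure_display) (Omega : measurableType dO) (Pr : probability Omega R)
  (P : Omega -> d.-tuple R) (X : Omega -> dataset n d)
  (Y : Omega -> d.-tuple R)
  (M : dataset n d -> probability (d.-tuple R) R) :
  0 < beta -> 0 < gamma -> 0 < k ->
  (* random variables *)
  measurable_fun [set: Omega] P ->
  (forall x, measurable (X @^-1` [set x])) ->
  measurable_fun [set: Omega] Y ->
  (* P^1, ..., P^d independent, each with law Beta(beta, beta) *)
  (forall A : 'I_d -> set R, (forall j, measurable (A j)) ->
     Pr (P @^-1` [set p | forall j, A j (tnth p j)]) =
     (\prod_(j < d) beta_mass beta (A j))%E) ->
  (* conditioned on P, the entries X_i^j are independent with E[X_i^j | P] = P^j *)
  (forall (B : set (d.-tuple R)) (x : dataset n d), measurable B ->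
     Pr (P @^-1` B `&` X @^-1` [set x]) =
     (\int[Pr]_(w in P @^-1` B) (data_lik x (P w))%:E)%E) ->
  (* Y = M(X): conditioned on (P, X), the output Y has law M X *)
  (forall (B : set (d.-tuple R)) (x : dataset n d) (S : set (d.-tuple R)),
     measurable B -> measurable S ->
     Pr (P @^-1` B `&` X @^-1` [set x] `&` Y @^-1` S) =
     (Pr (P @^-1` B `&` X @^-1` [set x]) * M x S)%E) ->
  (* M takes values in [-1,1]^d *)
  (forall x, M x [set y | forall j, -1 <= tnth y j <= 1] = 1%E) ->
  (* M is (1, beta gamma k / (n d))-differentially private *)
  diff_private M 1 (beta * gamma * k / (n%:R * d%:R)) ->
  (\int[Pr]_w (\sum_(j < d) tnth (Y w) j ^+ 2)%:E = k%:E)%E ->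
  ((gamma * k)%:E <=
     \int[Pr]_w (\sum_(j < d) tnth (Y w) j * (tnth (P w) j - 2^-1))%:E)%E ->
  gamma * beta * Num.sqrt k <= n%:R.
Proof.
move=> b0 g0 k0 mP mX mY law PX PXY Mcube dp Ysq Ycorr.
(* With [d = 0] the squared norm is an empty sum, against [k > 0]. *)
have d0 : (0 < d)%N.
  rewrite lt0n; apply/eqP => dE; move: Ysq.
  rewrite (_ : (fun w => _) = cst 0%E); last first.
    apply/funext => w; rewrite big1// => j _.
    by have h := leq_ltn_trans (leq0n j) (ltn_ord j); move: (lt0n_neq0 h) => /eqP /(_ dE).
  by rewrite integral0 => -[] /esym/eqP; rewrite gt_eqF.
have P01 := beta_prior_itv Pr P beta mP law.
pose cube : set (d.-tuple R) := [set y | forall j, -1 <= tnth y j <= 1].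
have mcube : measurable cube.
  rewrite (_ : cube = \bigcap_(j in [set: 'I_d])
      ((fun y : d.-tuple R => tnth y j) @^-1` `[-1, 1]%classic)).
    apply: fin_bigcap_measurable; first exact: finite_finset.
    by move=> j _; apply: measurable_preimageT => //; exact: measurable_tnth.
  apply/seteqP; split => y /= h; first by move=> j _ /=; rewrite in_itv; exact: h.
  by move=> j; have := h j Logic.I; rewrite /= in_itv.
have joint (f g : d.-tuple R -> R) : bounded_measurable f -> bounded_measurable g ->
    \int[Pr]_w (f (P w) * g (Y w)) =
    \sum_(x : dataset n d) \int[Pr]_w (f (P w) * lik_at P x w) * \int[M x]_y g y.
  exact: (expectation_joint Pr P X Y M mP mX mY P01 PX PXY).
have bcst := @bounded_measurable_cst R.
have bL (x : dataset n d) := bounded_measurable_lik_at P mP x.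
have bcl j := bounded_measurable_comp _ _ mP (@bounded_measurable_clamp_tuple R d j).
have sumL w : \sum_(x : dataset n d) lik_at P x w = 1 by exact: data_lik_sum1.
have ELsum : \sum_(x : dataset n d) \int[Pr]_w lik_at P x w = 1.
  rewrite -Rintegral_sum//; under eq_Rintegral do rewrite sumL.
  exact: Rintegral_probability_cst.
(* The support of [M x] passes to [Y] through [joint], with [f = 1] and [g] the indicator of the
   cube. *)
have Y11 : {ae Pr, forall w, forall j, -1 <= tnth (Y w) j <= 1}.
  have mYc : measurable (Y @^-1` cube) by exact: measurable_preimageT.
  have bind : bounded_measurable (\1_cube : d.-tuple R -> R).
    split; first exact: measurable_indic.
    by exists 1 => y; rewrite indicE; case: (y \in _); rewrite ?normr1 ?normr0.
  have PYc : Pr (Y @^-1` cube) = 1%E.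
    have -> : Pr (Y @^-1` cube) = (\int[Pr]_w (1 * \1_cube (Y w)))%:E.
      rewrite EFin_Rintegral; last first.
        apply: bounded_measurableM; first exact: bcst.
        exact: (bounded_measurable_comp _ _ mY bind).
      under eq_integral do rewrite mul1r.
      by rewrite -[X in Pr X = _]setIT -(integral_indic Pr measurableT).
    rewrite (joint (fun=> 1) _ (bcst _ _ _) bind); congr EFin.
    rewrite -[RHS]ELsum.
    apply: eq_bigr => x _; rewrite -[RHS]mulr1; congr (_ * _).
      by apply: eq_Rintegral => w _; rewrite mul1r.
    by rewrite /Rintegral integral_indic// setIT; exact: (congr1 fine (Mcube x)).
  exists (~` (Y @^-1` cube)); split.
  - exact: measurableC.
  - by rewrite probability_setC// PYc subee.
  - by move=> w /=.
have tY : {ae Pr, forall w, forall j, trunc (Y w) j = tnth (Y w) j}.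
  by apply: filterS Y11 => w h j; rewrite /trunc clamp_id.
have bt j := bounded_measurable_comp _ _ mY (@bounded_measurable_trunc R d j).
pose q x := sqnorm_output (M x).
(* The prescribed mean [k] is the average of the second moments [q x] over the law of the dataset;
   the variance term will integrate to it. *)
have kE : \sum_(x : dataset n d) \int[Pr]_w lik_at P x w * q x = k.
  apply: EFin_inj; rewrite -Ysq.
  have bsq := bounded_measurable_comp _ _ mY (@bounded_measurable_sqnorm R d).
  transitivity (\int[Pr]_w (\sum_(j < d) trunc (Y w) j ^+ 2)%:E)%E.
    rewrite -(EFin_Rintegral _ _ bsq); congr EFin.
    rewrite -[RHS](_ : \int[Pr]_w (1 * \sum_(j < d) trunc (Y w) j ^+ 2) = _); last first.
      by apply: eq_Rintegral => w _; rewrite mul1r.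
    rewrite (joint (fun=> 1) (fun y => \sum_(j < d) trunc y j ^+ 2)
      (bcst _ _ _) (@bounded_measurable_sqnorm R d)).
    apply: eq_bigr => x _; congr (_ * _).
    by apply: eq_Rintegral => w _; rewrite mul1r.
  apply: ae_eq_integral => //.
  - by apply/measurable_EFinP; case: bsq.
  - apply/measurable_EFinP; apply: measurable_sum => j.
    by apply: measurable_funX; exact: (measurableT_comp (measurable_tnth j) mY).
  - by apply: filterS tY => w h _; congr EFin; apply: eq_bigr => j _; rewrite h.
pose corr j := \int[Pr]_w ((tnth (clamp_tuple (P w)) j - 2^-1) * trunc (Y w) j).
have bf j : bounded_measurable (fun p : d.-tuple R => tnth (clamp_tuple p) j - 2^-1).
  by apply: bounded_measurableB; [exact: bounded_measurable_clamp_tuple|exact: bcst].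
have bfY j : bounded_measurable
    (fun w => (tnth (clamp_tuple (P w)) j - 2^-1) * trunc (Y w) j).
  apply: bounded_measurableM; last exact: bt.
  exact: (bounded_measurable_comp _ _ mP (bf j)).
have corr_ge : gamma * k <= \sum_(j < d) corr j.
  rewrite -lee_fin /corr -Rintegral_sum// EFin_Rintegral; last first.
    exact: bounded_measurable_sum.
  apply: le_trans Ycorr _; rewrite le_eqVlt; apply/orP; left; apply/eqP.
  apply: ae_eq_integral => //.
  - apply/measurable_EFinP; apply: measurable_sum => j; apply: measurable_funM.
      exact: (measurableT_comp (measurable_tnth j) mY).
    by apply: measurable_funB => //; exact: (measurableT_comp (measurable_tnth j) mP).
  - by apply/measurable_EFinP; case: (bounded_measurable_sum _ (index_enum 'I_d) _ bfY).
  - apply: filterS2 tY P01 => w hY hP _; congr EFin; apply: eq_bigr => j _.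
    by rewrite hY clamp_tuple_id// mulrC.
(* [S i w] is the conditional mean of [Z_i] given the parameters [P w]. As [Z_i] is linear in the
   output, [M x] enters through its means alone. *)
pose S i w := \sum_(x : dataset n d) data_lik x (clamp_tuple (P w)) *
  \sum_(j < d) ((tnth (tnth x i) j)%:R - tnth (clamp_tuple (P w)) j) *
    mean_output (M x) j.
have bterm (x : dataset n d) i j : bounded_measurable (fun w =>
    lik_at P x w * ((tnth (tnth x i) j)%:R - tnth (clamp_tuple (P w)) j)).
  apply: bounded_measurableM; first exact: bL.
  by apply: bounded_measurableB; [exact: bcst|exact: bcl].
(* [fingerprinting] for each [x] and [j], weighted by [mean_output (M x) j], which plays the role of
   [f(X)]; the rest is exchange of finite sums. *)
have SE : 2 * beta * \sum_(j < d) corr j = \sum_(i < n) \int[Pr]_w S i w.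
  have Si i : \int[Pr]_w S i w = \sum_(x : dataset n d) \sum_(j < d)
      \int[Pr]_w (lik_at P x w *
        ((tnth (tnth x i) j)%:R - tnth (clamp_tuple (P w)) j)) *
      mean_output (M x) j.
    transitivity (\int[Pr]_w \sum_(x : dataset n d) \sum_(j < d)
        (lik_at P x w * ((tnth (tnth x i) j)%:R - tnth (clamp_tuple (P w)) j)) *
        mean_output (M x) j).
      apply: eq_Rintegral => w _; apply: eq_bigr => x _.
      by rewrite mulr_sumr; apply: eq_bigr => j _; rewrite mulrA.
    have btm (x : dataset n d) j := bounded_measurableM _ _ (bterm x i j)
      (bcst _ _ (mean_output (M x) j)).
    rewrite Rintegral_sum => [|x]; last exact: bounded_measurable_sum.
    apply: eq_bigr => x _; rewrite Rintegral_sum//.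
    apply: eq_bigr => j _; rewrite RintegralZr//.
    exact: (bounded_measurable_integrable _ _ (bterm x i j)).
  transitivity (\sum_(j < d) \sum_(x : dataset n d) \sum_(i < n)
      \int[Pr]_w (lik_at P x w *
        ((tnth (tnth x i) j)%:R - tnth (clamp_tuple (P w)) j)) *
      mean_output (M x) j).
    rewrite mulr_sumr; apply: eq_bigr => j _.
    rewrite /corr (joint _ (trunc ^~ j) (bf j) (@bounded_measurable_trunc R d j)).
    rewrite mulr_sumr; apply: eq_bigr => x _.
    by rewrite mulrA (fingerprinting Pr P beta mP law x j b0) mulr_suml.
  rewrite exchange_big; under [RHS]eq_bigr do rewrite Si.
  rewrite [RHS]exchange_big; apply: eq_bigr => x _.
  by rewrite exchange_big.
(* The minimiser of [(t^2 + k / 4) / (4 t)], whose minimum is [sqrt k / 4]. *)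
pose t := Num.sqrt k / 2.
have t0 : 0 < t by rewrite divr_gt0// sqrtr_gt0.
set delta := beta * gamma * k / (n%:R * d%:R) in dp.
have delta0 : 0 <= delta by rewrite divr_ge0// !mulr_ge0// ltW.
have Sle i : \int[Pr]_w S i w <=
    expR 1 * ((t ^+ 2 + 4^-1 * k) / (4 * t)) + delta * d%:R.
  have bS : bounded_measurable (S i).
    apply: bounded_measurable_sum => x; apply: bounded_measurableM; first exact: bL.
    apply: bounded_measurable_sum => j; apply: bounded_measurableM; last exact: bcst.
    by apply: bounded_measurableB; [exact: bcst|exact: bcl].
  pose u w := \sum_(x : dataset n d) lik_at P x w * q x.
  have blq (x : dataset n d) := bounded_measurableM _ _ (bL x) (bcst _ _ (q x)).
  have bu : bounded_measurable u by exact: bounded_measurable_sum.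
  have uE : \int[Pr]_w u w = k.
    rewrite Rintegral_sum// -kE; apply: eq_bigr => x _; rewrite RintegralZr//.
    exact: (bounded_measurable_integrable _ _ (bL x)).
  (* The bound of [per_row_bound] at the parameters [P w] is [A * u w + B], and [u] integrates to
     [k]. *)
  pose A := expR 1 * (4^-1 / (4 * t)).
  pose B := expR 1 * (t ^+ 2 / (4 * t)) + delta * d%:R.
  have bAu : bounded_measurable (fun w => A * u w) by exact: bounded_measurableZ.
  have bB := bcst _ Omega B.
  apply: (@le_trans _ _ (\int[Pr]_w (A * u w + B))).
    apply: le_Rintegral => //.
    - exact: bounded_measurable_integrable.
    - exact/bounded_measurable_integrable/bounded_measurableD.
    move=> w _; apply: le_trans (per_row_bound M _ _ i _ delta0 dp
      (clamp_tuple_itv (P w)) t0) _.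
    rewrite le_eqVlt; apply/orP; left; apply/eqP.
    by rewrite /A /B /u /lik_at /q; ring.
  rewrite (RintegralD measurableT (bounded_measurable_integrable Pr _ bAu)
    (bounded_measurable_integrable Pr _ bB)).
  rewrite (RintegralZl _ measurableT (bounded_measurable_integrable Pr _ bu)) uE.
  rewrite Rintegral_probability_cst le_eqVlt; apply/orP; left; apply/eqP.
  by rewrite /A /B; ring.
have H : 2 * beta * (gamma * k) <=
    n%:R * (expR 1 * ((t ^+ 2 + 4^-1 * k) / (4 * t)) + delta * d%:R).
  apply: (@le_trans _ _ (2 * beta * \sum_(j < d) corr j)).
    by rewrite ler_wpM2l// mulr_ge0// ltW.
  rewrite SE; apply: le_trans (ler_sum _ (fun i _ => Sle i)) _.
  by rewrite sumr_const card_ord -[leLHS]mulr_natl.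
(* An equality for [n > 0]. For [n = 0] the left side is [0], and only the inequality survives. *)
have dn : n%:R * (delta * d%:R) <= beta * gamma * k.
  have [->|n0] := posnP n.
    by rewrite mul0r !mulr_ge0// ltW.
  rewrite le_eqVlt; apply/orP; left; apply/eqP; rewrite /delta.
  by field; rewrite !pnatr_eq0 -!lt0n n0 d0.
pose s := Num.sqrt k.
have s0 : 0 < s by rewrite sqrtr_gt0.
have sk : k = s ^+ 2 by rewrite sqr_sqrtr// ltW.
have tE : (t ^+ 2 + 4^-1 * k) / (4 * t) = s / 4.
  by rewrite sk /t -/s; field; rewrite gt_eqF.
have e4 := expR1_le4 R.
have n0 : 0 <= n%:R :> R by [].
(* The goal is multiplied by [s]. Of the two copies of [beta gamma k] on the left of [H], the
   additive loss of privacy absorbs one; the other is at most [n * s]. *)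
rewrite -(ler_pM2r s0) -/s.
have ns : n%:R * (expR 1 * (s / 4)) <= n%:R * s.
  by rewrite ler_wpM2l//; nra.
move: H; rewrite tE mulrDr => H.
rewrite (_ : gamma * beta * s * s = beta * (gamma * k)); last by rewrite sk; ring.
lra.
Qed.
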